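(* There is no algorithm which, given $\delta>0$ and (query access to) a realization of the coefficient field $\mathbf a=(\mathbf a_e)_{e\in\mathbb B}$, outputs a matrix $\hat{\mathbf a}_\delta\in\mathbb R^{d\times d}$ after performing $\mathcal N_\delta$ operations, in such a way that for every law $\mathbb P$ on $[1,\Lambda]^{\mathbb B}$ under which $(\mathbf a_e)_{e\in\mathbb B}$ are independent and identically distributed, the following two properties both hold: (i) $\mathbb E\big[|\bar{\mathbf a}-\hat{\mathbf a}_\delta|^2\big]^{1/2}\le\delta$ for every $\delta>0$, where $\bar{\mathbf a}$ is the homogenized matrix associated with $\mathbb P$; (ii) $\delta^{2}\mathcal N_\delta\to 0$ in $\mathbb P$-probability as $\delta\to0$ (that is, the algorithm uses $o(\delta^{-2})$ operations).
   Context: Fix a dimension $d\ge2$ and $\Lambda\in(1,\infty)$. $\mathbb B$ is the set of undirected nearest-neighbor edges of $\mathbb Z^d$, $\Omega=[1,\Lambda]^{\mathbb B}$ with the product $\sigma$-algebra, and $\mathbf a=(\mathbf a_e)_{e\in\mathbb B}$ is the canonical random variable on $\Omega$. $\mathbb P$ is a probability measure on $\Omega$ under which $(\mathbf a_e)_{e\in\mathbb B}$ are i.i.d., with expectation $\mathbb E$. Homogenized matrix. Let $\mathbf e_1,\dots,\mathbf e_d$ be the canonical basis, $(\theta_x\mathbf a)_e=\mathbf a_{x+e}$ ($x+e$ is the edge $e$ translated by $x\in\mathbb Z^d$). For $h:\Omega\to\mathbb R$ let $Dh(\mathbf a)=(h(\theta_{\mathbf e_1}\mathbf a)-h(\mathbf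 a),\dots,h(\theta_{\mathbf e_d}\mathbf a)-h(\mathbf a))$, and let $L^2_{\mathrm{pot}}(\Omega)$ be the closure in $L^2(\Omega,\mathbb R^d)$ of $\{Dh: h\in L^2(\Omega)\}$. On $\Omega$, $\mathbf a$ is also read as the diagonal matrix $\mathrm{diag}(\mathbf a_{\{0,\mathbf e_1\}},\dots,\mathbf a_{\{0,\mathbf e_d\}})$. For each unit vector $\xi\in\mathbb R^d$, the corrector gradient $D\phi=D\phi_\xi$ is the unique element of $L^2_{\mathrm{pot}}(\Omega)$ with $\mathbb E[F\cdot\mathbf a(\xi+D\phi)]=0$ for all $F\in L^2_{\mathrm{pot}}(\Omega)$. The homogenized matrix $\bar{\mathbf a}$ is the deterministic symmetric matrix with $\xi\cdot\bar{\mathbf a}\xi=\mathbb E[(\xi+D\phi)\cdot\mathbf a(\xi+D\phi)]$ for every unit vector $\xi$. Algorithms. The algorithm does not know the law $\mathbb P$; its input is $\delta$ and the realization of $\mathbf a$, whose values it may read one edge at a time (the next edge to be read may depend on $\delta$ and on the values already read). Any memory access, boolean operation, floating-point addition or multiplication counts as one operation; in particular reading the value of one conductance costs at least one operation. The output is a measurable function of $\delta$ and of the values read. The number $\mathcal N_\delta$ of operations performed is a random variable (a function of $\mathbf a$). *)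

(* Defs.v *)
From HB Require Import structures.
From mathcomp Require Import all_boot all_order all_algebra.
From mathcomp Require Import all_classical all_reals all_analysis.

Set Implicit Arguments.
Unset Strict Implicit.
Unset Printing Implicit Defensive.

Import Order.TTheory GRing.Theory Num.Theory.
Import numFieldNormedType.Exports.

Local Open Scope classical_set_scope.
Local Open Scope ring_scope.

Definition site (d : nat) := 'rV[int]_d.

(* [(x, i)] stands for the undirected edge {x, x + e_i}: every undirected
   nearest-neighbor edge of Z^d has exactly one such representation. *)
Definition edge (d : nat) := (site d * 'I_d)%type.

(* The interval [1, Lam]. Measurable types are pointed in the library, so its
   nonemptiness has to be part of the type: this is the only use of [hLam]. *)
Definition conductance (R : realType) (Lam : R) (hLam : 1 < Lam) :=
  {x : R | x \in `[1, Lam]}.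

Lemma one_in_conductance (R : realType) (Lam : R) (hLam : 1 < Lam) :
  1 \in `[1, Lam].
Proof. by rewrite in_itv /= lexx ltW. Qed.

HB.instance Definition _ (R : realType) (Lam : R) (hLam : 1 < Lam) :=
  Choice.on (conductance hLam).
HB.instance Definition _ (R : realType) (Lam : R) (hLam : 1 < Lam) :=
  isPointed.Build (conductance hLam)
    (exist (fun x : R => x \in `[1, Lam]) 1 (one_in_conductance hLam)).

Definition cylinder (R : realType) (d : nat) (Lam : R) (hLam : 1 < Lam) :
    set (set (edge d -> conductance hLam)) :=
  [set A | exists e : edge d, exists2 B : set R, measurable B &
             A = [set a | B (val (a e))]].

(* [1, Lam]^edges with the product sigma-algebra. *)
Definition Omega (R : realType) (d : nat) (Lam : R) (hLam : 1 < Lam) :=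
  g_sigma_algebraType (@cylinder R d Lam hLam).

Section Environment.
Context (R : realType) (d : nat) (Lam : R) (hLam : 1 < Lam).
Local Notation Om := (Omega d hLam).

Definition cond (a : Om) (e : edge d) : R := val (a e).

Definition shift (x : site d) (a : Om) : Om := fun e => a (x + e.1, e.2).

Definition iid (P : probability Om R) : Prop :=
  (forall (e e' : edge d) (B : set R), measurable B ->
     P [set a | B (cond a e)] = P [set a | B (cond a e')]) /\
  (forall (s : seq (edge d)) (B : edge d -> set R), uniq s ->
     (forall e, measurable (B e)) ->
     P [set a | forall e, e \in s -> B e (cond a e)] =
     (\prod_(e <- s) P [set a | B e (cond a e)])%E).

Definition dot (u v : 'cV[R]_d) : R := \sum_(i < d) u i 0 * v i 0.

(* Squared Euclidean norm of the entries; on square matrices this fixes |.| as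
   the Frobenius norm (another norm only rescales delta by a constant). *)
Definition sqnorm m n (A : 'M[R]_(m, n)) : R :=
  \sum_(i < m) \sum_(j < n) A i j ^+ 2.

Definition L2norm m n (P : probability Om R) (F : Om -> 'M[R]_(m, n)) : \bar R :=
  ('E_P[fun a => sqnorm (F a)] `^ 2^-1)%E.

Definition L2 (P : probability Om R) (F : Om -> 'cV[R]_d) : Prop :=
  forall i : 'I_d, (fun a => F a i 0) \in Lfun P 2%:E.

Definition grad (h : Om -> R) (a : Om) : 'cV[R]_d :=
  \col_i (h (shift (delta_mx 0 i) a) - h a).

Definition L2pot (P : probability Om R) (F : Om -> 'cV[R]_d) : Prop :=
  L2 P F /\
  forall eps : R, 0 < eps ->
    exists2 h : Om -> R, h \in Lfun P 2%:E &
      (L2norm P (fun a => (F a - grad h a)%R) < eps%:E)%E.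

Definition coef (a : Om) : 'M[R]_d := diag_mx (\row_i cond a (0, i)).

Definition is_corrector_gradient (P : probability Om R) (xi : 'cV[R]_d)
    (Dphi : Om -> 'cV[R]_d) : Prop :=
  L2pot P Dphi /\
  forall F : Om -> 'cV[R]_d, L2pot P F ->
    ('E_P[fun a => dot (F a) (coef a *m (xi + Dphi a))%R] = 0)%E.

(* [Dphi] is unique up to P-null sets, so the existential below does not
   depend on the chosen representative. *)
Definition is_homogenized_matrix (P : probability Om R) (abar : 'M[R]_d) :
    Prop :=
  abar^T = abar /\
  forall xi : 'cV[R]_d, sqnorm xi = 1 ->
    exists2 Dphi : Om -> 'cV[R]_d, is_corrector_gradient P xi Dphi &
      ((dot xi (abar *m xi)%R)%:E =
       'E_P[fun a => dot (xi + Dphi a)%R (coef a *m (xi + Dphi a))%R])%E.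

(* Values read during the first [n] steps on the realization [a]. Since the
   rule [query] is deterministic, the edges read so far are determined by
   these values; [None] means that nothing more is read. *)
Fixpoint reads (query : R -> seq R -> option (edge d)) (delta : R) (a : Om)
    (n : nat) : seq R :=
  if n is n'.+1 then
    let s := reads query delta a n' in
    if query delta s is Some e then rcons s (cond a e) else s
  else [::].

(* [nops] counts all the operations. Nothing is assumed about those that are
   not readings, hence the only constraint [stops]: all the readings are made
   within [nops] operations. No regularity of [query] is imposed; [output] is a
   Borel function of delta and of the values read, and both the number of
   operations and the estimator are random variables. *)
Record algorithm := Algorithm {
  query : R -> seq R -> option (edge d) ;
  output : R -> seq R -> 'M[R]_d ;
  nops : R -> Om -> nat ;
  stops : forall (delta : R) (a : Om), 0 < delta ->
    query delta (reads query delta a (nops delta a)) = None ;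
  measurable_nops : forall delta : R, 0 < delta ->
    measurable_fun [set: Om] (nops delta) ;
  measurable_output : forall (n : nat) (i j : 'I_d),
    measurable_fun [set: R * n.-tuple R]
      (fun v : R * n.-tuple R => output v.1 v.2 i j) ;
  measurable_estimate : forall (delta : R) (i j : 'I_d), 0 < delta ->
    measurable_fun [set: Om]
      (fun a => output delta (reads query delta a (nops delta a)) i j)
}.

Definition estimate (alg : algorithm) (delta : R) (a : Om) : 'M[R]_d :=
  output alg delta (reads (query alg) delta a (nops alg delta a)).

End Environment.

Arguments algorithm {R} d {Lam} hLam.

(* Main.v *)
Require Import Defs.
From HB Require Import structures.
From mathcomp Require Import all_boot all_order all_algebra.
From mathcomp Require Import all_classical all_reals all_analysis.
From mathcomp Require Import measurable_realfun ring lra.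

Set Implicit Arguments.
Unset Strict Implicit.
Unset Printing Implicit Defensive.

Import Order.TTheory GRing.Theory Num.Theory.
Import numFieldNormedType.Exports.

Local Open Scope classical_set_scope.
Local Open Scope ring_scope.

(** Le Cam's two-point method, along the Bernoulli laws.

    Let [P_p] be the law under which every conductance is [Lam] with
    probability [p] and [1] otherwise, and let [f p] be a fixed diagonal entry
    of its homogenized matrix.  Suppose that some algorithm has both properties.

    The function [f] then has zero derivative at every [p] of the open unit
    interval.  Given a tolerance [c], run the algorithm with
    [delta = c |h| / 4].  By (ii) it reads, under [P_p], at most
    [n = eps / delta ^ 2] values, apart from an event of small probability, and
    [n] is at most a small multiple of [h ^ -2].  On a decision tree of depth
    [n] the chi-square likelihood ratio of [P_p] and [P_(p+h)] is at most
    [(1 + h ^ 2 / (q (1 - q))) ^ n] with [q = p + h], even if the queries are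
    adaptive ([chi_square_accept]); this stays close to [1], so that the two
    laws cannot be told apart.  By (i) the output is nevertheless within
    [2 delta] of the right value with probability at least [3 / 4] under either
    law.  Hence [f (p + h)] and [f p] are less than [4 delta = c |h|] apart
    ([two_point_bound], [derivative_eq0]).  Property (ii) is used only at the
    fixed law [P_p], where it is available without any uniformity; at the
    moving law [P_(p+h)] only (i) is used, which is quantitative.

    By the mean value theorem [f] would be constant.  It is not: the arithmetic
    mean bounds [f] from above and (a linearization of) the harmonic mean bounds
    it from below ([homogenized_diag_le], [homogenized_diag_ge]), and these
    bounds separate [f (1 / 3)] from [f (1 - 1 / (3 Lam))].

    For this argument to say anything, the objects must exist.  The homogenized
    matrix comes from a Hilbert space projection ([form_projection]) for the
    energy form on square integrable fields, whose completeness is the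
    Riesz-Fischer theorem ([L2_completeness]).  The law [P_p] is the image of
    Lebesgue measure on the unit interval by an expansion in which successive
    digits are independent ([unit_law_digits], [bernoulli_iid]). *)

(** * Orthogonal projection for a complete semi-inner product *)

Lemma discriminant_le (R : realType) (A b e : R) :
  0 <= A -> (forall t, 0 <= A * t ^+ 2 + 2 * b * t + e) -> b ^+ 2 <= A * e.
Proof.
move=> A0 H.
have [A1|] := ltrP 0 A.
  have := H (- b / A).
  have -> : A * (- b / A) ^+ 2 + 2 * b * (- b / A) + e = e - b ^+ 2 / A.
    by field; rewrite gt_eqF.
  by rewrite subr_ge0 ler_pdivrMr// mulrC.
move=> A1; have {A1}A00 : A = 0 by apply/eqP; rewrite eq_le A0 A1.
have [->|b0] := eqVneq b 0; first by rewrite A00; lra.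
have := H (- (e + 1) / (2 * b)).
have -> : 2 * b * (- (e + 1) / (2 * b)) = - (e + 1).
  by field; rewrite b0 /=.
rewrite A00; lra.
Qed.

(** The elements of interest are functions, not classes of functions, and the
    form is only meaningful on the square integrable ones: hence the domain [D],
    and a form that is merely nonnegative. *)
Section Projection.
Context (R : realType) (V : lmodType R) (D : set V) (q : V -> V -> R).
Hypothesis DD : forall u v, D u -> D v -> D (u + v).
Hypothesis DZ : forall t u, D u -> D (t *: u).
Hypothesis qC : forall u v, D u -> D v -> q u v = q v u.
Hypothesis qDl : forall u v w, D u -> D v -> D w -> q (u + v) w = q u w + q v w.
Hypothesis qZl : forall t u w, D u -> D w -> q (t *: u) w = t * q u w.
Hypothesis q_ge0 : forall u, D u -> 0 <= q u u.

Let DN u : D u -> D (- u).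
Proof. by move=> Du; rewrite -scaleN1r; exact: DZ. Qed.

Let DB u v : D u -> D v -> D (u - v).
Proof. by move=> Du Dv; apply: DD => //; exact: DN. Qed.

Let qDr u v w : D u -> D v -> D w -> q w (u + v) = q w u + q w v.
Proof. by move=> Du Dv Dw; rewrite qC ?qDl 1?(qC Du)// 1?(qC Dv)//; exact: DD. Qed.

Let qZr t u w : D u -> D w -> q w (t *: u) = t * q w u.
Proof. by move=> Du Dw; rewrite qC ?qZl 1?(qC Du)//; exact: DZ. Qed.

Lemma form_expand u v t : D u -> D v ->
  q (u + t *: v) (u + t *: v) = q v v * t ^+ 2 + 2 * q v u * t + q u u.
Proof.
move=> Du Dv; have Dtv := DZ t Dv.
rewrite qDl ?qDr ?qZl ?qZr ?(qC Du Dv)//; try exact: DD.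
ring.
Qed.

Lemma form_cauchy_schwarz u v : D u -> D v -> q v u ^+ 2 <= q v v * q u u.
Proof.
move=> Du Dv; apply: discriminant_le; first exact: q_ge0.
by move=> t; rewrite -form_expand//; apply/q_ge0/DD => //; exact: DZ.
Qed.

Lemma form_addr_le u v : D u -> D v ->
  q (u + v) (u + v) <= 2 * q u u + 2 * q v v.
Proof.
move=> Du Dv; have := q_ge0 (DD Du (DZ (-1) Dv)).
have := form_expand 1 Du Dv; rewrite scale1r => ->.
rewrite form_expand//; lra.
Qed.

Definition form_closure (S : set V) : set V :=
  [set u | D u /\ forall e : R, 0 < e -> exists2 s, S s & q (u - s) (u - s) < e].

Variable S : set V.
Hypothesis SD : S `<=` D.
Hypothesis S0 : S 0.
Hypothesis SA : forall u v, S u -> S v -> S (u + v).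
Hypothesis SZ : forall t u, S u -> S (t *: u).

Lemma form_closureD u v :
  form_closure S u -> form_closure S v -> form_closure S (u + v).
Proof.
move=> [Du Hu] [Dv Hv]; split; first exact: DD.
move=> e e0; have e4 : 0 < e / 4 by lra.
have [s Ss Hs] := Hu _ e4; have [r Sr Hr] := Hv _ e4.
exists (s + r); first exact: SA.
rewrite opprD addrACA.
have := form_addr_le (DB Du (SD Ss)) (DB Dv (SD Sr)); lra.
Qed.

Lemma form_closureZ t u : form_closure S u -> form_closure S (t *: u).
Proof.
move=> [Du Hu]; split; first exact: DZ.
move=> e e0; have t0 : 0 < t ^+ 2 + 1 by rewrite ltr_wpDl// sqr_ge0.
have [|s Ss Hs] := Hu (e / (t ^+ 2 + 1)); first by rewrite divr_gt0.
exists (t *: s); first exact: SZ.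
have Dus := DB Du (SD Ss).
rewrite -scalerBr qZl ?qZr//; last exact: DZ.
move: Hs; rewrite ltr_pdivlMr// => Hs.
have := q_ge0 Dus; nra.
Qed.

Hypothesis complete : forall u : nat -> V, (forall n, D (u n)) ->
  (forall e : R, 0 < e -> exists N, forall m n, (N <= m)%N -> (N <= n)%N ->
     q (u m - u n) (u m - u n) < e) ->
  exists2 l, D l & forall e : R, 0 < e -> exists N, forall n, (N <= n)%N ->
     q (u n - l) (u n - l) < e.

(** The point of [z + S] of least energy.  A minimizing sequence is Cauchy by
    the parallelogram identity, and the first variation of the energy vanishes
    at its limit. *)
Lemma form_projection z : D z -> exists2 u, form_closure S u &
  forall w, form_closure S w -> q w (z + u) = 0.
Proof.
move=> Dz.
pose J s := q (z + s) (z + s).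
pose E := [set J s | s in S].
have J_ge0 s : S s -> 0 <= J s by move=> Ss; exact/q_ge0/DD/SD.
have Ei : has_inf E.
  split; first by exists (J 0); exists 0.
  by exists 0 => _ [s Ss <-]; exact: J_ge0.
pose m := inf E.
have mle s : S s -> m <= J s.
  by move=> Ss; apply: ge_inf; [exact: (proj2 Ei)|exists s].
have [r r_gt0 inv_small] : exists2 r : nat -> R, (forall n, 0 < r n) &
    forall e : R, 0 < e -> exists N, forall n, (N <= n)%N -> r n < e.
  exists (fun n => n.+1%:R^-1) => [n|e e0]; first by rewrite invr_gt0.
  exists (Num.truncn e^-1) => n Nn.
  rewrite invf_plt ?posrE//; apply: lt_le_trans (truncnS_gt _) _.
  by rewrite ler_nat ltnS.
have near_min n : exists s, S s /\ J s < m + r n.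
  have [|_ [s Ss <-] Hs] := @inf_adherent _ E (r n) _ Ei.
    exact: r_gt0.
  by exists s.
have [s Hs] := choice near_min.
have Ss n : S (s n) by case: (Hs n).
have Js n : J (s n) < m + r n by case: (Hs n).
have Ds n : D (s n) by exact: SD.
have cau k n : q (s k - s n) (s k - s n) <= 2 * (r k + r n).
  (* The midpoint of two almost minimizers has energy at least [m]. *)
  have Sh : S (2^-1 *: (s k + s n)) by apply/SZ/SA.
  have := mle _ Sh; have := Js k; have := Js n; rewrite /J.
  have Da := DD Dz (Ds k); have Db := DD Dz (Ds n).
  have -> : z + 2^-1 *: (s k + s n) = 2^-1 *: ((z + s k) + (z + s n)).
    rewrite [in RHS]addrACA [RHS]scalerDr -(mulr2n z) -(scaler_nat _ z) scalerA.
    by rewrite mulVf ?scale1r.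
  rewrite qZl ?qZr//; try exact/DZ/DD; try exact: DD.
  have -> : s k - s n = (z + s k) + (-1) *: (z + s n).
    by rewrite scaleN1r opprD addrACA subrr add0r.
  rewrite form_expand//.
  have := form_expand 1 Da Db; rewrite scale1r => ->.
  lra.
have [e e0|u Du Hu] := @complete s Ds.
  have [|N HN] := inv_small (e / 4); first by lra.
  exists N => k n Nk Nn; apply: le_lt_trans (cau k n) _.
  by have := HN k Nk; have := HN n Nn; lra.
have Cu : form_closure S u.
  split=> // e /Hu[N HN]; exists (s N) => //.
  rewrite -opprB -scaleN1r; have DsN := DB (Ds N) Du.
  by rewrite qZl ?qZr ?mulN1r ?opprK; first exact: HN; try exact: DZ.
(* Along the minimizing sequence the first variation in the direction [v] has
   square at most [q v v * r n]; then [n] goes to infinity. *)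
have orthS v : S v -> q v (z + u) = 0.
  move=> Sv; have Dv := SD Sv; have Dzu := DD Dz Du.
  apply/eqP; rewrite -sqrf_eq0 eq_le sqr_ge0 andbT.
  apply/ler_addgt0Pr => e e0; rewrite add0r.
  have A0 := q_ge0 Dv; pose A := q v v.
  have [|N HN] := inv_small (e / (4 * (A + 1))).
    by rewrite divr_gt0// mulr_gt0// ltr_wpDl.
  have [|N' HN'] := Hu (e / (4 * (A + 1))).
    by rewrite divr_gt0// mulr_gt0// ltr_wpDl.
  pose n := maxn N N'.
  have {}HN := HN n (leq_maxl _ _); have {}HN' := HN' n (leq_maxr _ _).
  have Dzn := DD Dz (Ds n); have Dun := DB (Ds n) Du.
  have -> : z + u = (z + s n) + (-1) *: (s n - u).
    by rewrite scaleN1r opprB addrACA subrr addr0.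
  rewrite qDr ?qZr//; last exact: DZ.
  have H1 : q v (z + s n) ^+ 2 <= A * (r n).
    apply: discriminant_le => // t.
    have := mle _ (SA (Ss n) (SZ t Sv)); rewrite /J addrA form_expand//.
    have := Js n; rewrite /J /A; lra.
  have := form_cauchy_schwarz Dun Dv.
  have H2 : A * (r n) <= e / 4.
    apply: le_trans (ler_wpM2l A0 (ltW HN)) _.
    rewrite mulrA ler_pdivrMr ?mulr_gt0// ?ltr_wpDl// /A; nra.
  have H3 : A * q (s n - u) (s n - u) <= e / 4.
    apply: le_trans (ler_wpM2l A0 (ltW HN')) _.
    rewrite mulrA ler_pdivrMr ?mulr_gt0// ?ltr_wpDl// /A; nra.
  rewrite -/A; move: H1 H2 H3; move: (q v (z + s n)) (q v (s n - u)) => x y.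
  move=> ? ? ? ?; have := sqr_ge0 (x + y); nra.
exists u => // w [Dw Hw].
have Dzu := DD Dz Du.
apply/eqP; rewrite -sqrf_eq0 eq_le sqr_ge0 andbT.
apply/ler_addgt0Pr => e e0; rewrite add0r.
have A0 := q_ge0 Dzu; pose A := q (z + u) (z + u).
have [|v Sv Hv] := Hw (e / (A + 1)).
  by rewrite divr_gt0// ltr_wpDl.
have Dwv := DB Dw (SD Sv).
have -> : q w (z + u) = q (w - v) (z + u).
  by rewrite -{1}(subrK v w) (qDl Dwv (SD Sv) Dzu)
    (orthS v)// addr0.
apply: le_trans (form_cauchy_schwarz Dzu Dwv) _.
apply: le_trans (ler_wpM2r A0 (ltW Hv)) _.
rewrite mulrAC ler_pdivrMr// ?ltr_wpDl// -/A; nra.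
Qed.

End Projection.

(** * Completeness of the space of square integrable functions *)

Lemma cvg_of_summable_variation (R : realType) (v : R^nat) :
  (\sum_(n <oo) `|v n.+1 - v n|%:E \is a fin_num)%E -> cvgn v.
Proof.
move=> S.
have /normed_cvg : cvgn [normed series (telescope v)].
  apply: nondecreasing_is_cvgn.
    by apply: nondecreasing_series => n _ _; exact: normr_ge0.
  exists (fine (\sum_(n <oo) `|v n.+1 - v n|%:E)%E) => _ [n _ <-].
  rewrite -lee_fin fineK// /series /= -sumEFin.
  apply: (@nneseries_lim_ge _ (fun k => `|v k.+1 - v k|%:E) xpredT) => k _ _.
  by rewrite lee_fin.
rewrite telescopeK.
move=> cv; have -> : v = (fun=> v 0%N) + (fun n => v n - v 0%N).
  by apply/funext => n; rewrite fctE addrC subrK.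
by apply: is_cvgD => //; exact: is_cvg_cst.
Qed.

Section SquareIntegrable.
Context d (T : measurableType d) (R : realType) (P : probability T R).
Implicit Types f g : T -> R.

Lemma Lfun_measurable p f : f \in Lfun P p -> measurable_fun setT f.
Proof. by rewrite inE => /andP[/[!inE]]. Qed.

Lemma Lfun2P f : f \in Lfun P 2%:E <->
  measurable_fun setT f /\ (\int[P]_x (f x ^+ 2)%:E < +oo)%E.
Proof.
split=> [Hf|[mf fi]].
  split; first exact: Lfun_measurable Hf.
  have := Lfun2_integrable_sqr Hf => /integrableP[_].
  apply: le_lt_trans; apply: ge0_le_integral => //=.
  - by move=> x _; rewrite lee_fin sqr_ge0.
  - by apply/measurable_EFinP/measurable_funX/Lfun_measurable/Hf.
  - apply/measurable_EFinP/measurableT_comp => //.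
    exact/measurable_funX/Lfun_measurable/Hf.
  - by move=> x _; rewrite lee_fin ler_norm.
rewrite inE; apply/andP; split; rewrite inE//=.
rewrite /finite_norm unlock /Lnorm poweR_lty//.
under eq_integral => x _ do rewrite [X in (X `^ _)%E](_ : _ = `|f x|%:E)//
  poweR_EFin powR_mulrn// -normrX ger0_norm ?sqr_ge0//.
by [].
Qed.

Lemma L2_mul_integrable f g : f \in Lfun P 2%:E -> g \in Lfun P 2%:E ->
  P.-integrable setT (EFin \o (fun x => f x * g x)).
Proof. by move=> Hf Hg; apply/Lfun1_integrable/Lfun2_mul_Lfun1. Qed.

Lemma L2_bounded_mul (c : R) f g : measurable_fun setT g ->
  (forall x, `|g x| <= c) -> f \in Lfun P 2%:E ->
  (fun x => g x * f x) \in Lfun P 2%:E.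
Proof.
move=> mg gc /Lfun2P[mf fi]; apply/Lfun2P; split; first exact: measurable_funM.
have mf2 : measurable_fun setT (fun x => (f x ^+ 2)%:E).
  exact/measurable_EFinP/measurable_funX.
apply: (@le_lt_trans _ _ (\int[P]_x ((c ^+ 2)%:E * (f x ^+ 2)%:E))%E).
  apply: ge0_le_integral => //=.
  - by move=> x _; rewrite lee_fin sqr_ge0.
  - by apply/measurable_EFinP/measurable_funX/measurable_funM.
  - by apply: measurable_funeM.
  - move=> x _; rewrite -EFinM lee_fin exprMn ler_wpM2r ?sqr_ge0//.
    by rewrite -[g x ^+ 2]real_normK ?num_real// lerXn2r ?nnegrE// (le_trans _ (gc x)).
rewrite ge0_integralZl_EFin ?sqr_ge0//; last first.
  by move=> x _; rewrite lee_fin sqr_ge0.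
by rewrite lte_mul_pinfty// lee_fin sqr_ge0.
Qed.

Local Notation E f := (\int[P]_x f x)%R.

Lemma L2_sqr_EFin f : f \in Lfun P 2%:E ->
  (\int[P]_x (f x ^+ 2)%:E)%E = (E (fun x => f x ^+ 2))%:E.
Proof.
by move=> /Lfun2_integrable_sqr Hf; rewrite /Rintegral fineK// integrable_fin_num.
Qed.

(** A subsequence with increments of mean square below [4 ^ -k] has increments of
    mean below [2 * 2 ^ -k]; their sum is integrable, hence finite almost
    everywhere, so the subsequence converges almost everywhere.  By Fatou's
    lemma the limit is also the limit in mean square. *)
Lemma L2_completeness (u : nat -> T -> R) :
  (forall n, u n \in Lfun P 2%:E) ->
  (forall e : R, 0 < e -> exists N, forall m n, (N <= m)%N -> (N <= n)%N ->
     E (fun x => (u m x - u n x) ^+ 2) < e) ->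
  exists2 l, l \in Lfun P 2%:E & forall e : R, 0 < e -> exists N, forall n,
     (N <= n)%N -> E (fun x => (u n x - l x) ^+ 2) < e.
Proof.
move=> L2u cau.
have mu n : measurable_fun setT (u n) by exact: Lfun_measurable (L2u n).
have L2B f g : f \in Lfun P 2%:E -> g \in Lfun P 2%:E ->
    (fun x => f x - g x) \in Lfun P 2%:E.
  by move=> Hf Hg; apply: (@rpredB _ (Lfun P 2%:E)) => //; rewrite lee1n.
have rho_gt0 k : 0 < (4^-1 : R) ^+ k by rewrite exprn_gt0.
have [N HN] := choice (fun k => cau _ (rho_gt0 k)).
pose fix s k := if k is k'.+1 then maxn (s k') (N k) else N 0%N.
have sN k : (N k <= s k)%N by case: k => //= k; rewrite leq_maxr.
have sS k : (s k <= s k.+1)%N by rewrite /= leq_maxl.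
have sle k j : (k <= j)%N -> (s k <= s j)%N.
  by move=> kj; apply: (@homo_leq _ s (fun a b => a <= b)%N) kj => //; exact: leq_trans.
pose v k := u (s k).
have L2v k : v k \in Lfun P 2%:E by exact: L2u.
have mv k : measurable_fun setT (v k) by exact: mu.
have L1 k : (\int[P]_x `|v k.+1 x - v k x|%:E <= (2 * 2^-1 ^+ k)%:E)%E.
  have H := HN k (s k.+1) (s k) (leq_trans (sN k) (sS k)) (sN k).
  have D2 := L2B _ _ (L2v k.+1) (L2v k).
  have i2 := Lfun2_integrable_sqr D2.
  apply: (@le_trans _ _ (\int[P]_x
      ((2 ^+ k)%:E * ((v k.+1 x - v k x) ^+ 2)%:E + (2^-1 ^+ k)%:E))%E).
    apply: ge0_le_integral => //=.
    - apply/measurable_EFinP/measurableT_comp => //.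
      exact: measurable_funB.
    - apply: emeasurable_funD => //; apply: measurable_funeM.
      by apply/measurable_EFinP/measurable_funX/measurable_funB.
    (* [t |y| <= t ^ 2 y ^ 2 + 1] with [t = 2 ^ k]. *)
    - move=> x _; rewrite -EFinM -EFinD lee_fin.
      have t0 : 0 < (2 : R) ^+ k by rewrite exprn_gt0.
      rewrite -(@real_normK _ (_ - _)) ?num_real// exprVn.
      move: (normr_ge0 (v k.+1 x - v k x)); move: `|_| => y y0.
      rewrite -(ler_pM2l t0) mulrDr mulfV ?gt_eqF//.
      have := sqr_ge0 (2 ^+ k * y - 1); nra.
  have mD2 : measurable_fun setT (fun x => ((v k.+1 x - v k x) ^+ 2)%:E).
    by apply/measurable_EFinP/measurable_funX/measurable_funB.
  rewrite ge0_integralD//=; last 2 first.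
  - by move=> x _; rewrite -EFinM lee_fin mulr_ge0// ?sqr_ge0// exprn_ge0.
  - exact: measurable_funeM.
  rewrite ge0_integralZl_EFin ?exprn_ge0//; last first.
    by move=> x _; rewrite lee_fin sqr_ge0.
  rewrite L2_sqr_EFin// integral_cst//= probability_setT mule1 -EFinM -EFinD.
  rewrite lee_fin [2 * _]mulrDl !mul1r lerD2r.
  rewrite -lter_pdivlMl ?exprn_gt0//; apply: le_trans (ltW H) _.
  by rewrite -!exprVn -exprMn lerXn2r// ?nnegrE//; lra.
have cv_ae : {ae P, forall x, cvgn (v ^~ x)}.
  pose S x := (\sum_(n <oo) `|v n.+1 x - v n x|%:E)%E.
  have mS n : measurable_fun setT (fun x => `|v n.+1 x - v n x|%:E).
    by apply/measurable_EFinP/measurableT_comp => //; exact: measurable_funB.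
  have iS : P.-integrable setT S.
    apply/integrableP; split.
      by apply: ge0_emeasurable_sum => // n x _ _; rewrite lee_fin.
    under eq_integral.
      move=> x _; rewrite gee0_abs; last first.
        by apply: nneseries_ge0 => n _ _; rewrite lee_fin.
      over.
    rewrite integral_nneseries//.
    apply: (@le_lt_trans _ _ (\sum_(n <oo) (2 * 2^-1 ^+ n)%:E)%E).
      apply: lee_nneseries => n _; last exact: L1.
      by move=> _; apply: integral_ge0 => x _; rewrite lee_fin.
    apply: le_lt_trans (ltry (4 : R)).
    apply: lime_le.
      by apply: is_cvg_nneseries => n _ _; rewrite lee_fin mulr_ge0// exprn_ge0.
    apply: nearW => n; rewrite sumEFin lee_fin.
    have -> : \sum_(0 <= i < n) 2 * 2^-1 ^+ i = 4 - 4 * 2^-1 ^+ n :> R.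
      elim: n => [|n IH]; first by rewrite big_nil expr0; lra.
      by rewrite big_nat_recr//= IH exprS; lra.
    by rewrite gerBl mulr_ge0// exprn_ge0.
  have := integrable_ae measurableT iS.
  by apply: filterS => x /(_ I); exact: cvg_of_summable_variation.
(* The upper limit is measurable, and equals the limit wherever the subsequence
   converges. *)
pose l x := fine (limn_esup (fun n => (v n x)%:E)).
have ml : measurable_fun setT l.
  apply: measurableT_comp => //; apply: measurable_fun_limn_esup => n.
  exact/measurable_EFinP.
have lE x : cvgn (v ^~ x) -> v ^~ x @ \oo --> l x.
  move=> cv; suff -> : l x = limn (v ^~ x) by [].
  rewrite /l is_cvg_limn_esupE; first by rewrite EFin_lim.
  by apply/cvg_ex; exists (limn (v ^~ x))%:E; apply/cvg_EFin; [exact: nearW|].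
have bound k n : (N k <= n)%N ->
    (\int[P]_x ((u n x - l x) ^+ 2)%:E <= (4^-1 ^+ k)%:E)%E.
  move=> Nkn.
  pose g j x := ((u n x - v j x) ^+ 2)%:E.
  have mg j : measurable_fun setT (g j).
    by apply/measurable_EFinP/measurable_funX/measurable_funB.
  have g0 j x : setT x -> (0%E <= g j x)%E by move=> _; rewrite lee_fin sqr_ge0.
  have -> : (\int[P]_x ((u n x - l x) ^+ 2)%:E = \int[P]_x limn_einf (g ^~ x))%E.
    apply: ge0_ae_eq_integral => //.
    - by apply/measurable_EFinP/measurable_funX/measurable_funB.
    - under eq_fun => x do rewrite -(oppeK (limn_einf _)) -limn_esupN.
      apply: measurableT_comp => //; apply: measurable_fun_limn_esup => j.
      by apply: measurableT_comp => //.
    - by move=> x _; rewrite lee_fin sqr_ge0.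
    - move=> x _; rewrite limn_einf_lim; apply: lime_ge; first exact: is_cvg_einfs.
      by apply: nearW => j; apply: le_ereal_inf_tmp => _ [i _ <-]; exact: g0.
    - apply: filterS cv_ae => x /lE cv _.
      apply/esym/(cvg_limn_einf_sup _).1; rewrite /g.
      apply/cvg_EFin; first exact: nearW.
      rewrite /comp /=; under eq_fun do rewrite expr2.
      by rewrite expr2; apply: cvgM; apply: cvgB => //; exact: cvg_cst.
  apply: le_trans (fatou P measurableT mg g0) _.
  rewrite limn_einf_lim; apply: lime_le; first exact: is_cvg_einfs.
  apply: nearW => j; pose i := maxn j k.
  apply: (@le_trans _ _ (\int[P]_x g i x)%E).
    by apply: ereal_inf_lbound; exists i => //=; rewrite leq_maxl.
  rewrite L2_sqr_EFin ?lee_fin; last exact: L2B.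
  apply/ltW/HN => //; apply: leq_trans (sN k) _; apply: sle; exact: leq_maxr.
have L2l : l \in Lfun P 2%:E.
  have -> : l = (fun x => u (N 0%N) x - (u (N 0%N) x - l x)).
    by apply/funext => x; rewrite opprB addrC subrK.
  apply: L2B => //; apply/Lfun2P; split; first exact: measurable_funB.
  by apply: le_lt_trans (bound 0%N _ (leqnn _)) _; rewrite ltry.
exists l => // e e0.
have [k Hk] : exists k, (4^-1 : R) ^+ k < e.
  have /cvgr0_norm_lt : (4^-1 : R) ^+ n @[n --> \oo] --> 0.
    by apply: cvg_expr; rewrite ger0_norm//; lra.
  move=> /(_ _ e0)[k _ /(_ k (leqnn _))] Hk; exists k.
  by apply: le_lt_trans Hk; rewrite ler_norm.
exists (N k) => n Nn; apply: le_lt_trans Hk.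
rewrite -lee_fin -L2_sqr_EFin; first exact: bound.
exact: L2B.
Qed.

End SquareIntegrable.

(** * Laws on the conductances and their invariance under translations *)

Section Product.
Context (R : realType) (d : nat) (Lam : R) (hLam : 1 < Lam).
Local Notation Om := (Omega d hLam).

Lemma measurable_cond (e : edge d) : measurable_fun [set: Om] (fun a => cond a e).
Proof.
move=> _ B mB; rewrite setTI; apply: sub_sigma_algebra.
by exists e; exists B.
Qed.

Lemma cond_ge1 (a : Om) e : 1 <= cond a e.
Proof. by have := valP (a e); rewrite in_itv /= => /andP[]. Qed.

Lemma cond_le (a : Om) e : cond a e <= Lam.
Proof. by have := valP (a e); rewrite in_itv /= => /andP[]. Qed.

Lemma measurable_to_Omega d' (T : measurableType d') (X : T -> Om) :
  (forall e, measurable_fun setT (fun x => cond (X x) e)) ->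
  measurable_fun setT X.
Proof.
move=> mX; apply: (@measurability _ _ T Om setT X (@cylinder R d Lam hLam)) => //.
by move=> _ [_ [e [B mB ->]] <-]; exact: mX.
Qed.

Lemma measurable_shift (x : site d) : measurable_fun [set: Om] (Defs.shift x).
Proof. by apply: measurable_to_Omega => e; exact: measurable_cond (x + e.1, e.2). Qed.

HB.instance Definition _ x :=
  isMeasurableFun.Build _ _ Om Om (Defs.shift x) (measurable_shift x).

Definition box (s : seq (edge d)) (B : edge d -> set R) : set Om :=
  [set a | forall e, e \in s -> B e (cond a e)].

Lemma measurable_box s B : (forall e, measurable (B e)) -> measurable (box s B).
Proof.
move=> mB; elim: s => [|e s IH].
  by rewrite (_ : box [::] B = setT)//; apply/seteqP; split.
rewrite (_ : box (e :: s) B = [set a | B e (cond a e)] `&` box s B).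
  apply: measurableI => //; rewrite -[X in measurable X]setTI.
  exact: measurable_cond.
apply/seteqP; split => [a H|a [H1 H2] e'].
  by split=> [|e' e's]; apply: H; rewrite inE ?eqxx// e's orbT.
by rewrite inE => /predU1P[->//|]; exact: H2.
Qed.

Definition boxes : set (set Om) := [set A | exists s B,
  [/\ uniq s, forall e, measurable (B e) & A = box s B]].

Lemma boxes_setI : setI_closed boxes.
Proof.
move=> _ _ [s [B [us mB ->]]] [s' [B' [us' mB' ->]]].
exists (undup (s ++ s')), (fun e => (if e \in s then B e else setT) `&`
  (if e \in s' then B' e else setT)); split.
- exact: undup_uniq.
- by move=> e; apply: measurableI; case: ifP.
- apply/seteqP; split => [a [H H'] e _|a H].
    by split; case: ifP => //; [exact: H|exact: H'].
  split=> e es; have := H e; rewrite mem_undup mem_cat es ?orbT => /(_ isT)[].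
    by [].
  by [].
Qed.

(** The boxes form a pi-system that generates the product sigma-algebra. *)
Lemma Omega_measure_unique (P Q : probability Om R) :
  (forall s B, uniq s -> (forall e, measurable (B e)) ->
     P (box s B) = Q (box s B)) ->
  forall A, measurable A -> P A = Q A.
Proof.
move=> PQ A mA.
apply: (@measure_unique _ _ _ boxes (fun=> setT)) => //.
- rewrite eqEsubset; split.
    apply: smallest_sub; first exact: smallest_sigma_algebra.
    move=> _ [e [B mB ->]]; apply: sub_sigma_algebra.
    exists [:: e], (fun=> B); split=> //; apply/seteqP; split=> a H.
      by move=> e'; rewrite inE => /eqP->.
    by apply: H; rewrite inE.
  apply: smallest_sub; first exact: sigma_algebra_measurable.
  by move=> _ [s [B [us mB ->]]]; exact: measurable_box.
- exact: boxes_setI.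
- move=> _; exists [::], (fun=> setT); split => //.
  by apply/seteqP; split.
- by rewrite bigcup_const.
- by move=> _ [s [B [us mB ->]]]; exact: PQ.
- by move=> _; apply: le_lt_trans (probability_le1 P measurableT) (ltry _).
Qed.

Lemma iid_shift (P : probability Om R) : iid P -> forall x A, measurable A ->
  P (Defs.shift x @^-1` A) = P A.
Proof.
move=> [Pid Pind] x A mA.
apply: (@Omega_measure_unique (distribution P (Defs.shift x)) P) => // s B us mB.
pose t e : edge d := (x + e.1, e.2).
have tI : injective t.
  by move=> [y i] [z j] [/addrI -> ->].
have tK e : t (e.1 - x, e.2) = e by rewrite /t /= addrC subrK; case: e.
transitivity (P (box (map t s) (fun e => B (e.1 - x, e.2)))).
  congr (P _); apply/seteqP; split => a H e.
    move=> /mapP[e' e's ->] /=; rewrite (addrC x) addrK.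
    by have := H e' e's; case: e' {e's}.
  move=> es; have := H (t e); rewrite (mem_map tI) => /(_ es).
  by rewrite /= (addrC x) addrK; case: e es.
have ut : uniq (map t s) by rewrite map_inj_uniq.
have mBt e : measurable (B (e.1 - x, e.2)) by [].
apply: etrans (Pind (map t s) (fun e => B (e.1 - x, e.2)) ut mBt) _.
apply: etrans _ (esym (Pind s B us mB)).
rewrite big_map; apply: eq_bigr => e _ /=.
by rewrite (addrC x) addrK -surjective_pairing; apply: Pid.
Qed.

End Product.

(** * The energy form *)

Section Energy.
Context (R : realType) (d : nat) (Lam : R) (hLam : 1 < Lam).
Local Notation Om := (Omega d hLam).
Context (P : probability Om R).
Implicit Types F G : Om -> 'cV[R]_d.

(** The sum is outside of the integral so that bilinearity reduces to
    one-dimensional integrals; [expectation_energy] gives back the usual form. *)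
Definition energy F G : R :=
  \sum_i \int[P]_a (cond a (0, i) * F a i 0 * G a i 0).

Lemma L2_cond_mul (f : Om -> R) e :
  f \in Lfun P 2%:E -> (fun a => cond a e * f a) \in Lfun P 2%:E.
Proof.
apply: (@L2_bounded_mul _ _ _ _ Lam); first exact: measurable_cond.
by move=> a; rewrite ger0_norm ?cond_le// (le_trans ler01)// cond_ge1.
Qed.

Lemma energy_integrable F G i : L2 P F -> L2 P G ->
  P.-integrable setT (EFin \o (fun a => cond a (0, i) * F a i 0 * G a i 0)).
Proof.
by move=> F2 G2; apply: L2_mul_integrable => //; exact/L2_cond_mul/F2.
Qed.

Lemma expectation_fsum (I : Type) (r : seq I) (f : I -> Om -> R) :
  (forall i, P.-integrable setT (EFin \o f i)) ->
  ('E_P[fun a => (\sum_(i <- r) f i a)%R] = (\sum_(i <- r) \int[P]_a f i a)%R%:E)%E.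
Proof.
move=> fi; rewrite unlock -sumEFin.
under eq_integral do rewrite -sumEFin.
rewrite (@integral_sum _ _ _ _ _ measurableT _ (fun i a => (f i a)%:E)) => //.
apply: eq_bigr => i _.
by rewrite /Rintegral fineK//; apply: integrable_fin_num => //; exact: fi.
Qed.

Lemma expectation_energy F G : L2 P F -> L2 P G ->
  ('E_P[fun a => dot (F a) (coef a *m G a)%R] = (energy F G)%:E)%E.
Proof.
move=> F2 G2; rewrite -expectation_fsum; last by move=> i; exact: energy_integrable.
congr expectation; apply/funext => a; apply: eq_bigr => i _.
by rewrite /coef mul_diag_mx !mxE mulrA (mulrC (F a i 0)).
Qed.

Lemma L2D F G : L2 P F -> L2 P G -> L2 P (F + G).
Proof.
move=> F2 G2 i; under eq_fun do rewrite fctE mxE.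
by apply: (@rpredD _ (Lfun P 2%:E)) => //; rewrite lee1n.
Qed.

Lemma L2Z t F : L2 P F -> L2 P (t *: F).
Proof.
move=> F2 i; under eq_fun do rewrite fctE mxE.
by apply: (@L2_bounded_mul _ _ _ _ `|t| (fun a => F a i 0) (fun=> t)).
Qed.

Lemma L2_cst (v : 'cV[R]_d) : L2 P (fun=> v).
Proof. by move=> i; exact: Lfun_cst. Qed.

Lemma energyC F G : energy F G = energy G F.
Proof.
by apply: eq_bigr => i _; apply: eq_Rintegral => a _; rewrite -!mulrA (mulrC (F a i 0)).
Qed.

Lemma energyDl F G H : L2 P F -> L2 P G -> L2 P H ->
  energy (F + G) H = energy F H + energy G H.
Proof.
move=> F2 G2 H2; rewrite /energy -big_split; apply: eq_bigr => i _ /=.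
rewrite -RintegralD//; try exact: energy_integrable.
by apply: eq_Rintegral => a _; rewrite fctE mxE; ring.
Qed.

Lemma energyZl t F H : L2 P F -> L2 P H -> energy (t *: F) H = t * energy F H.
Proof.
move=> F2 H2; rewrite /energy mulr_sumr; apply: eq_bigr => i _ /=.
rewrite -RintegralZl//; last exact: energy_integrable.
by apply: eq_Rintegral => a _; rewrite fctE mxE; ring.
Qed.

Lemma energy_ge0 F : 0 <= energy F F.
Proof.
apply: sumr_ge0 => i _; apply: Rintegral_ge0 => a _.
by rewrite -mulrA -expr2 mulr_ge0 ?sqr_ge0// (le_trans ler01)// cond_ge1.
Qed.

Definition meansq F : R := \sum_i \int[P]_a (F a i 0 ^+ 2).

Lemma meansq_le_energy F : L2 P F -> meansq F <= energy F F.
Proof.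
move=> F2; apply: ler_sum => i _; apply: le_Rintegral => //.
- exact/Lfun2_integrable_sqr/F2.
- exact: energy_integrable.
- by move=> a _; rewrite -mulrA -expr2 ler_peMl ?sqr_ge0// cond_ge1.
Qed.

Lemma energy_le_meansq F : L2 P F -> energy F F <= Lam * meansq F.
Proof.
move=> F2; rewrite mulr_sumr; apply: ler_sum => i _.
have iF : P.-integrable setT (EFin \o (fun a => F a i 0 ^+ 2)).
  exact/Lfun2_integrable_sqr/F2.
rewrite -RintegralZl//; apply: le_Rintegral => //.
- exact: energy_integrable.
- exact: (integrableZl measurableT Lam iF).
- by move=> a _; rewrite -mulrA -expr2 ler_wpM2r ?sqr_ge0// cond_le.
Qed.

Lemma expectation_sqnorm F : L2 P F ->
  ('E_P[fun a => sqnorm (F a)] = (meansq F)%:E)%E.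
Proof.
move=> F2; rewrite -expectation_fsum; last by move=> i; exact/Lfun2_integrable_sqr/F2.
congr expectation; apply/funext => a; apply: eq_bigr => i _.
by rewrite big_ord1.
Qed.

Lemma L2norm_lt F e : L2 P F -> 0 < e ->
  (L2norm P F < e%:E)%E = (meansq F < e ^+ 2).
Proof.
move=> F2 e0; rewrite /L2norm expectation_sqnorm// poweR_EFin lte_fin.
have m0 : 0 <= meansq F.
  by apply: sumr_ge0 => i _; apply: Rintegral_ge0 => a _; rewrite sqr_ge0.
by rewrite powR12_sqrt// -{1}(gtr0_norm e0) -sqrtr_sqr ltr_sqrt ?exprn_gt0//.
Qed.

Lemma L2_complete (u : nat -> Om -> 'cV[R]_d) : (forall n, L2 P (u n)) ->
  (forall e : R, 0 < e -> exists N, forall m n, (N <= m)%N -> (N <= n)%N ->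
     energy (u m - u n) (u m - u n) < e) ->
  exists2 l, L2 P l & forall e : R, 0 < e -> exists N, forall n, (N <= n)%N ->
     energy (u n - l) (u n - l) < e.
Proof.
move=> u2 cau.
have L2N F : L2 P F -> L2 P (- F) by move=> F2; rewrite -scaleN1r; exact: L2Z.
have comp i : exists l : Om -> R, l \in Lfun P 2%:E /\ forall e : R, 0 < e ->
    exists N, forall n, (N <= n)%N -> \int[P]_a ((u n a i 0 - l a) ^+ 2) < e.
  have [||l l2 Hl] := @L2_completeness _ _ _ P (fun n a => u n a i 0).
  - by move=> n; exact: u2.
  - move=> e e0; have [N HN] := cau e e0; exists N => m n Nm Nn.
    apply: le_lt_trans (HN m n Nm Nn).
    apply: le_trans (meansq_le_energy (L2D (u2 m) (L2N _ (u2 n)))).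
    rewrite /meansq (bigD1 i)//= -[X in X <= _]addr0; apply: lerD.
      by rewrite le_eqVlt; apply/orP/or_introl/eqP/eq_Rintegral => a _; rewrite !fctE !mxE.
    by apply: sumr_ge0 => j _; apply: Rintegral_ge0 => a _; rewrite sqr_ge0.
  - by exists l.
have [l Hl] := choice comp.
pose L : Om -> 'cV[R]_d := fun a => \col_i l i a.
have L2L : L2 P L.
  by move=> i; under eq_fun do rewrite mxE; case: (Hl i).
exists L => // e e0.
have e1 : 0 < e / (Lam * d.+1%:R).
  by rewrite divr_gt0// mulr_gt0 ?ltr0n// (lt_trans ltr01).
have [N HN] := choice (fun i => (Hl i).2 _ e1).
exists (\max_i N i)%N => n Nn.
apply: le_lt_trans (energy_le_meansq (L2D (u2 n) (L2N _ L2L))) _.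
rewrite /meansq -ltr_pdivlMl; last by rewrite (lt_trans ltr01).
apply: (@le_lt_trans _ _ (\sum_(i < d) (e / (Lam * d.+1%:R)))).
  apply: ler_sum => i _; apply: ltW.
  apply: le_lt_trans (HN i n _); last exact: leq_trans (leq_bigmax i) Nn.
  by rewrite le_eqVlt; apply/orP/or_introl/eqP/eq_Rintegral => a _; rewrite !fctE !mxE.
rewrite sumr_const card_ord -[_ *+ d]mulr_natl.
have Lam0 : 0 < Lam by rewrite (lt_trans ltr01).
have -> : d%:R * (e / (Lam * d.+1%:R)) = Lam^-1 * e * (d%:R / d.+1%:R).
  by field; rewrite gt_eqF//= gt_eqF// ltr0n.
by rewrite gtr_pMr ?mulr_gt0 ?invr_gt0// ltr_pdivrMr ?ltr0n// mul1r ltr_nat.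
Qed.

End Energy.

(** * Correctors and homogenized matrices *)

(** The convexity bound [c x ^ 2 >= 2 t x - t ^ 2 / c] at [t = L], followed by the
    chord bound [1 / c <= (1 + L - c) / L] on the interval from [1] to [L].  The
    lower bound is affine in [c], so that its mean only involves the mean of
    [c]. *)
Lemma tangent_le (R : realType) (L c x : R) : 1 <= c -> c <= L ->
  2 * L * x - (L * (1 + L) - L * c) <= c * x * x.
Proof.
move=> c1 cL; have c0 : 0 < c by lra.
have H : 0 <= (c * x - L) ^+ 2 + L * (c - 1) * (L - c).
  by rewrite addr_ge0 ?sqr_ge0// !mulr_ge0//; lra.
rewrite -subr_ge0 -(pmulr_rge0 _ c0).
have -> : c * (c * x * x - (2 * L * x - (L * (1 + L) - L * c))) =
  (c * x - L) ^+ 2 + L * (c - 1) * (L - c) by ring.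
exact: H.
Qed.

Section Homogenization.
Context (R : realType) (d : nat) (Lam : R) (hLam : 1 < Lam).
Local Notation Om := (Omega d hLam).
Context (P : probability Om R).
Hypothesis stationary : forall x A, measurable A ->
  P (Defs.shift x @^-1` A) = P A.
Implicit Types F G : Om -> 'cV[R]_d.

Lemma integral_shift x (f : Om -> \bar R) : measurable_fun setT f ->
  (forall a, 0 <= f a)%E ->
  (\int[P]_a f (Defs.shift x a) = \int[P]_a f a)%E.
Proof.
move=> mf f0.
rewrite -(@ge0_integral_distribution _ _ _ _ _ P (Defs.shift x) f)//.
by apply: eq_measure_integral => A mA _; exact: stationary.
Qed.

Lemma L2_shift x (h : Om -> R) : h \in Lfun P 2%:E ->
  (fun a => h (Defs.shift x a)) \in Lfun P 2%:E.
Proof.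
move=> /Lfun2P[mh hi]; apply/Lfun2P; split.
  exact: measurableT_comp mh (measurable_shift x).
rewrite (@integral_shift x (fun a => (h a ^+ 2)%:E))//.
- exact/measurable_EFinP/measurable_funX.
- by move=> a; rewrite lee_fin sqr_ge0.
Qed.

Lemma Lfun2_integrable (h : Om -> R) : h \in Lfun P 2%:E ->
  P.-integrable setT (EFin \o h).
Proof.
by move=> h2; apply/Lfun1_integrable; apply: Lfun_subset12 => //; exact: fin_num_measure.
Qed.

Lemma Rintegral_shift x (h : Om -> R) : h \in Lfun P 2%:E ->
  \int[P]_a h (Defs.shift x a) = \int[P]_a h a.
Proof.
move=> h2; rewrite /Rintegral; congr fine.
rewrite -(@integral_distribution _ _ _ _ _ P (Defs.shift x) (EFin \o h))//.
- by apply: eq_measure_integral => A mA _; exact: stationary.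
- exact/measurable_EFinP/Lfun_measurable/h2.
- exact: Lfun2_integrable (L2_shift x h2).
Qed.

Lemma L2_grad (h : Om -> R) : h \in Lfun P 2%:E -> L2 P (grad h).
Proof.
move=> h2 i; under eq_fun do rewrite mxE.
by apply: (@rpredB _ (Lfun P 2%:E)) => //; [rewrite lee1n|move=> ?; exact: L2_shift].
Qed.

Definition gradients : set (Om -> 'cV[R]_d) :=
  [set grad h | h in [set h : Om -> R | h \in Lfun P 2%:E]].

Lemma gradients_L2 : gradients `<=` L2 P.
Proof. by move=> _ [h h2 <-]; exact: L2_grad. Qed.

Lemma gradients0 : gradients 0.
Proof.
exists (fun=> 0); first exact: Lfun_cst.
by apply/funext => a; apply/matrixP => i j; rewrite !mxE subrr.
Qed.

Lemma gradientsD F G : gradients F -> gradients G -> gradients (F + G).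
Proof.
move=> [f f2 <-] [g g2 <-]; exists (f \+ g).
  by apply: (@rpredD _ (Lfun P 2%:E)) => //; rewrite lee1n.
by apply/funext => a; apply/matrixP => i j; rewrite fctE !mxE /=; ring.
Qed.

Lemma gradientsZ t F : gradients F -> gradients (t *: F).
Proof.
move=> [f f2 <-]; exists (fun a => t * f a).
  exact: (@L2_bounded_mul _ _ _ _ `|t| f (fun=> t)).
by apply/funext => a; apply/matrixP => i j; rewrite fctE !mxE /=; ring.
Qed.

(** The conductances lie between [1] and [Lam], so the energy and the mean square
    define the same closure. *)
Lemma L2potE F : L2pot P F <-> form_closure (L2 P) (@energy _ _ _ _ P) gradients F.
Proof.
have L2B G H : L2 P G -> L2 P H -> L2 P (G - H).
  by move=> G2 H2; apply: L2D => //; rewrite -scaleN1r; exact: L2Z.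
have Lam0 : 0 < Lam by rewrite (lt_trans ltr01).
split=> -[F2 HF]; split=> // e e0.
  have [|h h2 Hh] := HF (Num.sqrt (e / Lam)).
    by rewrite sqrtr_gt0 divr_gt0.
  exists (grad h); first by exists h.
  have Fh2 := L2B _ _ F2 (L2_grad h2).
  apply: le_lt_trans (energy_le_meansq Fh2) _.
  rewrite -ltr_pdivlMl// mulrC.
  move: Hh; rewrite (@L2norm_lt _ _ _ _ _ (F - grad h))// ?sqrtr_gt0 ?divr_gt0//.
  by rewrite sqr_sqrtr// divr_ge0// ltW.
have [|_ [h h2 <-] Hh] := HF (e ^+ 2); first by rewrite exprn_gt0.
exists h => //.
rewrite (@L2norm_lt _ _ _ _ _ (F - grad h))//; last exact/L2B/L2_grad.
apply: le_lt_trans Hh; apply: meansq_le_energy; exact/L2B/L2_grad.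
Qed.

Lemma corrector_exists (xi : 'cV[R]_d) : exists Dphi, is_corrector_gradient P xi Dphi.
Proof.
have [u Cu orth] := @form_projection R _ (L2 P) (@energy _ _ _ _ P)
  (@L2D _ _ _ _ P) (@L2Z _ _ _ _ P) (fun u v _ _ => energyC P u v)
  (@energyDl _ _ _ _ P) (@energyZl _ _ _ _ P) (fun u _ => energy_ge0 P u)
  gradients gradients_L2 gradients0 gradientsD gradientsZ (@L2_complete _ _ _ _ P)
  (fun=> xi) (L2_cst P xi).
exists u; split; first exact/L2potE.
move=> F PF; have [F2 _] := PF.
rewrite (expectation_energy F2 (L2D (L2_cst P xi) (Cu.1))).
by congr (_%:E); apply: orth; apply/L2potE.
Qed.

Lemma L2potD F G : L2pot P F -> L2pot P G -> L2pot P (F + G).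
Proof.
move=> /L2potE F2 /L2potE G2; apply/L2potE.
apply: form_closureD => //.
- exact: L2D.
- exact: L2Z.
- by move=> u v _ _; exact: energyC.
- exact: energyDl.
- exact: energyZl.
- by move=> u _; exact: energy_ge0.
- exact: gradients_L2.
- exact: gradientsD.
Qed.

Lemma L2potZ t F : L2pot P F -> L2pot P (t *: F).
Proof.
move=> /L2potE F2; apply/L2potE.
apply: form_closureZ => //.
- exact: L2D.
- exact: L2Z.
- by move=> u v _ _; exact: energyC.
- exact: energyZl.
- by move=> u _; exact: energy_ge0.
- exact: gradients_L2.
- exact: gradientsZ.
Qed.

Lemma energy0l G : L2 P G -> energy P 0 G = 0.
Proof.
move=> G2; rewrite -(scale0r (0 : Om -> 'cV[R]_d)) energyZl ?mul0r//.
exact: (L2_cst P 0).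
Qed.

Lemma L2pot0 : L2pot P (0 : Om -> 'cV[R]_d).
Proof.
apply/L2potE; split; first exact: L2_cst.
move=> e e0; exists 0; first exact: gradients0.
by rewrite subr0 energy0l //; exact: (L2_cst P 0).
Qed.

Lemma L2_sum (I : Type) (r : seq I) (F : I -> Om -> 'cV[R]_d) :
  (forall i, L2 P (F i)) -> L2 P (\sum_(i <- r) F i).
Proof.
by move=> F2; apply: big_ind => //; [exact: L2_cst|move=> *; exact: L2D].
Qed.

Lemma energy_sumZl (I : Type) (r : seq I) (c : I -> R) (F : I -> Om -> 'cV[R]_d) G :
  (forall i, L2 P (F i)) -> L2 P G ->
  energy P (\sum_(i <- r) c i *: F i) G = \sum_(i <- r) c i * energy P (F i) G.
Proof.
move=> F2 G2; elim: r => [|i r IH].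
  by rewrite !big_nil energy0l.
rewrite !big_cons energyDl ?IH ?energyZl//; first exact: L2Z.
by apply: L2_sum => j; exact: L2Z.
Qed.

(** Correctors can be chosen linear in the direction, by superposing those of the
    basis vectors; the homogenized energy is then a quadratic form. *)
Lemma homogenized_matrix_exists : exists abar, is_homogenized_matrix P abar.
Proof.
have [Phi HPhi] := choice (fun i : 'I_d => corrector_exists (delta_mx i 0)).
have Phi2 i : L2 P (Phi i) by case: (HPhi i) => -[].
pose G i : Om -> 'cV[R]_d := (fun=> delta_mx i 0) + Phi i.
have G2 i : L2 P (G i) by apply: L2D => //; exact: L2_cst.
exists (\matrix_(i, j) energy P (G i) (G j)); split.
  by apply/matrixP => i j; rewrite !mxE energyC.
move=> xi _.
pose Dphi : Om -> 'cV[R]_d := \sum_i xi i 0 *: Phi i.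
have Dphi2 : L2 P Dphi by apply: L2_sum => i; exact: L2Z.
have xiD : (fun=> xi) + Dphi = \sum_i xi i 0 *: G i.
  under [RHS]eq_bigr do rewrite scalerDr.
  rewrite big_split /=; congr (_ + _); apply/funext => a.
  rewrite fct_sumE; apply/matrixP => k j; rewrite ord1 summxE (bigD1 k)//=.
  rewrite fctE !mxE !eqxx mulr1 big1 ?addr0// => l lk.
  by rewrite fctE !mxE eq_sym (negbTE lk) mulr0.
have GG2 : L2 P ((fun=> xi) + Dphi) by apply: L2D => //; exact: L2_cst.
exists Dphi; last first.
  rewrite (expectation_energy GG2 GG2) xiD; congr (_%:E).
  rewrite energy_sumZl//; last by apply: L2_sum => i; exact: L2Z.
  apply: eq_bigr => i _; congr (_ * _); rewrite energyC energy_sumZl// mxE.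
  by apply: eq_bigr => j _; rewrite mxE energyC mulrC.
split.
  by apply: big_ind => [|F F' HF HF'|i _]; [exact: L2pot0|exact: L2potD|
    apply: L2potZ; case: (HPhi i)].
move=> F PF; have [F2 _] := PF.
rewrite (expectation_energy F2 GG2) xiD energyC energy_sumZl// big1// => i _.
have := (HPhi i).2 F PF; rewrite (expectation_energy F2 (G2 i)) energyC.
by move=> [->]; rewrite mulr0.
Qed.

Lemma Rintegral_probability (c : R) : \int[P]_a c = c.
Proof.
by rewrite Rintegral_cst//; have /= -> := probability_setT P; rewrite mulr1.
Qed.

Lemma Rintegral_sqr_le (f : Om -> R) : f \in Lfun P 2%:E ->
  (\int[P]_a f a) ^+ 2 <= \int[P]_a (f a ^+ 2).
Proof.
move=> f2; set m := \int[P]_a f a.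
have if2 := Lfun2_integrable_sqr f2; have if1 := Lfun2_integrable f2.
have ic (c : R) : P.-integrable setT (EFin \o (fun=> c)).
  exact: finite_measure_integrable_cst.
have : 0 <= \int[P]_a ((f a - m) ^+ 2).
  by apply: Rintegral_ge0 => a _; rewrite sqr_ge0.
under eq_Rintegral.
  move=> a _; rewrite (_ : _ ^+ 2 = f a ^+ 2 - ((2 * m) * f a - m ^+ 2)); last by ring.
  over.
have iZ : P.-integrable setT (EFin \o (fun a => 2 * m * f a)).
  exact: (integrableZl measurableT (2 * m) if1).
rewrite RintegralB//; last exact: (integrableB measurableT iZ (ic _)).
rewrite RintegralB// RintegralZl// Rintegral_probability -/m; lra.
Qed.

(** By stationarity a gradient has mean zero, and this passes to limits in mean
    square. *)
Lemma Rintegral_L2pot F i : L2pot P F -> \int[P]_a F a i 0 = 0.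
Proof.
move=> [F2 HF]; apply/eqP; rewrite -sqrf_eq0 eq_le sqr_ge0 andbT.
apply/ler_addgt0Pr => e e0; rewrite add0r.
have [|h h2 Hh] := HF (Num.sqrt e); first by rewrite sqrtr_gt0.
have g2 := L2_grad h2.
have Fg2 : L2 P (F - grad h) by apply: L2D => //; rewrite -scaleN1r; exact: L2Z.
move: Hh; rewrite (L2norm_lt Fg2) ?sqrtr_gt0// sqr_sqrtr ?(ltW e0)// => Hh.
have -> : \int[P]_a F a i 0 = \int[P]_a ((F - grad h) a i 0).
  have E : \int[P]_a grad h a i 0 = 0.
    under eq_Rintegral do rewrite mxE.
    rewrite RintegralB ?Rintegral_shift ?subrr//; [|exact: Lfun2_integrable].
    exact/Lfun2_integrable/L2_shift.
  have FgE a : (F - grad h) a i 0 = F a i 0 - grad h a i 0.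
    by rewrite fctE [LHS]mxE [X in _ + X]mxE.
  under [RHS]eq_Rintegral do rewrite FgE.
  rewrite RintegralB ?E ?subr0//; first exact: Lfun2_integrable.
  by apply: Lfun2_integrable; exact: g2.
apply: le_trans (Rintegral_sqr_le (Fg2 i)) _; apply/ltW; apply: le_lt_trans Hh.
rewrite /meansq (bigD1 i)//= lerDl; apply: sumr_ge0 => j _.
by apply: Rintegral_ge0 => a _; rewrite sqr_ge0.
Qed.

(** [G] is the corrected field [e_i + Dphi].  Since [Dphi] is orthogonal to [G] in
    energy, one copy of [G] may be replaced with [e_i]. *)
Lemma homogenized_diag (abar : 'M[R]_d) i : is_homogenized_matrix P abar ->
  exists2 G, L2 P G & [/\ energy P G G = abar i i,
    energy P (fun=> delta_mx i 0) G = abar i i & \int[P]_a G a i 0 = 1].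
Proof.
move=> [_ /(_ (delta_mx i 0)) []].
  rewrite /sqnorm (bigD1 i)//= !big_ord1 mxE !eqxx expr1n big1 ?addr0// => j ji.
  by rewrite big_ord1 mxE (negbTE ji) expr0n.
move=> Dphi [PD orth].
have c2 := L2_cst P (delta_mx i 0); have [D2 _] := PD.
have G2 := L2D c2 D2.
rewrite (expectation_energy G2 G2) => -[E].
have dE : dot (delta_mx i 0) (abar *m delta_mx i 0) = abar i i.
  rewrite /dot (bigD1 i)//= big1 => [|j ji].
    by rewrite -colE !mxE !eqxx mul1r addr0.
  by rewrite mxE (negbTE ji) mul0r.
exists ((fun=> delta_mx i 0) + Dphi) => //.
have := orth _ PD; rewrite (expectation_energy D2 G2) => -[Z].
rewrite -E dE; split => //; first by rewrite -dE E energyDl// Z addr0.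
under eq_Rintegral do rewrite fctE mxE [X in X + _]mxE !eqxx.
rewrite RintegralD//.
- by rewrite Rintegral_probability Rintegral_L2pot// addr0.
- exact: finite_measure_integrable_cst.
- exact: Lfun2_integrable.
Qed.

Lemma cond_L2 e : (fun a : Om => cond a e) \in Lfun P 2%:E.
Proof.
have := @L2_cond_mul _ _ _ _ P (fun=> 1) e (Lfun_cst P 1 2).
by under eq_fun do rewrite mulr1.
Qed.

(** The energy of [e_i - G] is nonnegative, and equals the arithmetic mean minus
    [abar i i]. *)
Lemma homogenized_diag_le (abar : 'M[R]_d) i : is_homogenized_matrix P abar ->
  abar i i <= \int[P]_a cond a (0, i).
Proof.
move=> /(@homogenized_diag _ i)[G G2 [E1 E2 _]].
have c2 := L2_cst P (delta_mx i 0).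
have := energy_ge0 P ((fun=> delta_mx i 0) + (-1) *: G).
rewrite (form_expand (@L2D _ _ _ _ P) (@L2Z _ _ _ _ P) (fun u v _ _ => energyC P u v)
  (@energyDl _ _ _ _ P) (@energyZl _ _ _ _ P))//.
rewrite (energyC _ G) E1 E2.
suff -> : energy P (fun=> delta_mx i 0) (fun=> delta_mx i 0) =
  \int[P]_a cond a (0, i) by lra.
rewrite /energy (bigD1 i)//= big1 ?addr0 => [|j ji].
  by apply: eq_Rintegral => a _; rewrite mxE !eqxx !mulr1.
under eq_Rintegral do rewrite mxE (negbTE ji) mulr0.
exact: Rintegral_probability.
Qed.

(** The bound [tangent_le] applied to the corrected field, whose mean is known. *)
Lemma homogenized_diag_ge (abar : 'M[R]_d) i : is_homogenized_matrix P abar ->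
  Lam - Lam * (Lam - \int[P]_a cond a (0, i)) <= abar i i.
Proof.
move=> /(@homogenized_diag _ i)[G G2 [<- _ G1]].
have c2 := cond_L2 (0, i).
have Lam0 : 0 < Lam by rewrite (lt_trans ltr01).
apply: (@le_trans _ _ (\int[P]_a (cond a (0, i) * G a i 0 * G a i 0))); last first.
  rewrite /energy (bigD1 i)//= lerDl; apply: sumr_ge0 => j _.
  apply: Rintegral_ge0 => a _.
  by rewrite -mulrA -expr2 mulr_ge0 ?sqr_ge0// (le_trans ler01)// cond_ge1.
have iG : P.-integrable setT (EFin \o (fun a => (2 * Lam) * G a i 0)).
  exact: (integrableZl measurableT (2 * Lam) (Lfun2_integrable (G2 i))).
have iK : P.-integrable setT (EFin \o (fun=> Lam * (1 + Lam))).
  exact: finite_measure_integrable_cst.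
have iC : P.-integrable setT (EFin \o (fun a => Lam * cond a (0, i))).
  exact: (integrableZl measurableT Lam (Lfun2_integrable c2)).
have iB := integrableB measurableT iK iC.
have -> : Lam - Lam * (Lam - \int[P]_a cond a (0, i)) =
  \int[P]_a (2 * Lam * G a i 0 - (Lam * (1 + Lam) - Lam * cond a (0, i))).
  rewrite RintegralB// RintegralB// Rintegral_probability.
  rewrite !RintegralZl ?G1//; try exact: Lfun2_integrable.
  by ring.
apply: le_Rintegral => //.
- exact: (integrableB measurableT iG iB).
- exact: energy_integrable.
by move=> a _; apply: tangent_le; [exact: cond_ge1|exact: cond_le].
Qed.


End Homogenization.

(** * Independent Bernoulli digits on the unit interval *)

Section Digits.
Context (R : realType).
Implicit Types (p x : R) (w : seq bool) (Cs : seq (pred bool)).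

Definition unit_interval : set (measurableTypeR R) := `[(0 : R), 1[.

Lemma measurable_unit_interval : measurable unit_interval.
Proof. exact: measurable_itv. Qed.

Definition unit_law := mrestr (@lebesgue_measure R) measurable_unit_interval.

HB.instance Definition _ := Measure.copy unit_law
  (mrestr (@lebesgue_measure R) measurable_unit_interval).

Lemma unit_law_setT : unit_law setT = 1%E.
Proof.
by rewrite /unit_law /mrestr setTI lebesgue_measure_itv /= lte_fin ltr01 oppr0 adde0.
Qed.

HB.instance Definition _ :=
  Measure_isProbability.Build _ _ _ unit_law unit_law_setT.

(** The piecewise affine map that sends each of the intervals from [0] to [p] and
    from [p] to [1] onto the whole unit interval.  A digit records in which of
    the two an iterate lies; for [p = 1 / 2] these are the binary digits. *)
Definition expand p x : R := if x < p then x / p else (x - p) / (1 - p).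

Definition digit p n x : bool := iter n (expand p) x < p.

Definition weight p (b : bool) : R := if b then p else 1 - p.

Fixpoint starts p w x : bool :=
  if w is b :: w' then ((x < p) == b) && starts p w' (expand p x) else true.

Fixpoint digits_in p Cs x : bool :=
  if Cs is C :: Cs' then C (x < p) && digits_in p Cs' (expand p x) else true.

Lemma measurable_expand p : measurable_fun setT (expand p).
Proof.
apply: measurable_fun_ifT.
- exact: measurable_fun_ltr.
- exact: measurable_funM.
- by apply: measurable_funM => //; exact: measurable_funB.
Qed.

Lemma measurable_digit p n : measurable_fun setT (digit p n).
Proof.
apply: measurable_fun_ltr => //.
elim: n => [|n IH]; first exact: measurable_id.
rewrite [X in measurable_fun _ X](_ : _ = expand p \o (fun x => iter n (expand p) x))//.
exact: (measurableT_comp (measurable_expand p) IH).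
Qed.

Lemma starts_rcons p w b x : starts p (rcons w b) x =
  starts p w x && ((iter (size w) (expand p) x < p) == b).
Proof.
elim: w x => [|b' w IH] x /=; first by rewrite andbT.
by rewrite IH andbA -iterSr.
Qed.

Lemma digits_inP p N (C : nat -> pred bool) x :
  digits_in p (mkseq C N) x = [forall i : 'I_N, C i (digit p i x)].
Proof.
elim: N C x => [|N IH] C x.
  by apply/esym/forallP => -[].
rewrite /mkseq /= -[1%N]addn0 iotaDl -map_comp /=.
rewrite (IH (C \o S)); apply/andP/forallP => [[C0 /forallP CS] [[|i] iN]//|H].
  by have := CS (Ordinal (iN : (i < N)%N)); rewrite /digit /= -iterSr.
split; first exact: (H ord0).
apply/forallP => i; have := H (lift ord0 i).
by rewrite /digit /= /bump /= -iterSr.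
Qed.

Definition mass p (C : pred bool) : R :=
  (C true)%:R * p + (C false)%:R * (1 - p).

Context (p : R).
Hypothesis p01 : 0 < p < 1.

(** Each affine branch of [expand] multiplies lengths by the inverse of the weight
    of its digit, so the points with prescribed first digits fill an interval
    whose length is the product of the weights. *)
Lemma starts_itv w : exists l, [/\ 0 <= l, l + \prod_(b <- w) weight p b <= 1 &
  [set x | 0 <= x < 1 /\ starts p w x] =
  [set` `[l, l + \prod_(b <- w) weight p b[] ].
Proof.
have [p0 p1] := andP p01.
elim: w => [|b w [l [l0 l1 E]]].
  exists 0; rewrite big_nil add0r; split => //.
  by apply/seteqP; split => x; rewrite /= in_itv /=; [case|].
rewrite big_cons; set W := \prod_(_ <- _) _ in l1 E *.
have W0 : 0 < W by apply: prodr_gt0 => -[] _; rewrite /weight; lra.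
have q0 : 0 < 1 - p by lra.
have Ex x : (0 <= expand p x < 1 /\ starts p w (expand p x)) <-> (l <= expand p x < l + W).
  by have := congr1 (fun A => A (expand p x)) E; rewrite /= in_itv /= => ->.
case: b => /=.
  exists (p * l); split; [nra|nra|].
  apply/seteqP; split => x; rewrite /= in_itv /=.
    move=> [/andP[x0 x1] /andP[/eqP xp]]; move: (Ex x); rewrite /expand xp => -[+ _] s.
    rewrite ler_pdivlMr// ltr_pdivrMr// mul1r mul0r x0 xp => /(_ (conj isT s)).
    by rewrite ler_pdivlMr// ltr_pdivrMr// => /andP[? ?]; apply/andP; split; nra.
  move=> /andP[lx xl]; have xp : x < p by nra.
  move: (Ex x); rewrite /expand xp => -[_].
  rewrite !ler_pdivlMr// !ltr_pdivrMr// mul1r => -[|].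
    by apply/andP; split; nra.
  by move=> /andP[? ?] s; split; [apply/andP; split => //; nra|rewrite s].
exists (p + (1 - p) * l); split; [nra|nra|].
apply/seteqP; split => x; rewrite /= in_itv /=.
  move=> [/andP[x0 x1] /andP[/eqP xp]]; move: (Ex x); rewrite /expand xp => -[+ _] s.
  move/negbT: xp; rewrite -leNgt => xp.
  rewrite ler_pdivlMr// ltr_pdivrMr// mul1r mul0r subr_ge0 ltrD2r x1 xp => /(_ (conj isT s)).
  by rewrite ler_pdivlMr// ltr_pdivrMr// => /andP[? ?]; apply/andP; split; nra.
move=> /andP[lx xl]; have xp : (x < p) = false by apply/negbTE; rewrite -leNgt; nra.
move: (Ex x); rewrite /expand xp => -[_].
move/negbT: (xp); rewrite -leNgt => px.
rewrite !ler_pdivlMr// !ltr_pdivrMr// mul1r => -[|].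
  by apply/andP; split; nra.
by move=> /andP[? ?] s; split; [apply/andP; split => //; nra|rewrite s].
Qed.

Let piece w Cs := [set x | 0 <= x < 1 /\
  starts p w x && digits_in p Cs (iter (size w) (expand p) x)].

(** Fixing one more digit splits the set into two pieces of the same kind, so the
    product formula follows by induction from the case of intervals. *)
Lemma lebesgue_piece w Cs : measurable (piece w Cs) /\
  lebesgue_measure (piece w Cs) =
    (\prod_(b <- w) weight p b * \prod_(C <- Cs) mass p C)%:E.
Proof.
have [p0 p1] := andP p01.
elim: Cs w => [|C Cs IH] w.
  have [l [l0 l1 E]] := starts_itv w.
  have -> : piece w [::] = [set x | 0 <= x < 1 /\ starts p w x].
    by apply/seteqP; split => x; rewrite /piece /= andbT.
  rewrite E; split; first exact: measurable_itv.
  have W0 : 0 < \prod_(b <- w) weight p b.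
    by apply: prodr_gt0 => -[] _; rewrite /weight; lra.
  rewrite lebesgue_measure_itv /= lte_fin ltrDl W0 big_nil mulr1.
  by rewrite -EFinB; congr (_%:E); ring.
have E : piece w (C :: Cs) =
    (if C true then piece (rcons w true) Cs else set0) `|`
    (if C false then piece (rcons w false) Cs else set0).
  apply/seteqP; split => x.
    move=> /= [x01 /and3P[sw Cw dC]].
    move: Cw; case xb : (iter _ _ _ < p) => Cw; rewrite Cw; [left|right];
      by rewrite /piece /= size_rcons starts_rcons sw xb x01.
  case=> /=; case: ifP => // Cb [x01]; rewrite size_rcons starts_rcons
    => /andP[/andP[sw /eqP xb] dC]; by rewrite /piece /= sw xb Cb.
have disj : (if C true then piece (rcons w true) Cs else set0) `&`
    (if C false then piece (rcons w false) Cs else set0) = set0.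
  apply/seteqP; split => // x [].
  case: ifP => // _; case: ifP => // _ [_]; rewrite starts_rcons
    => /andP[/andP[_ /eqP xb] _] [_].
  by rewrite starts_rcons xb => /andP[/andP[_ ]].
have [mt Et] := IH (rcons w true); have [mf Ef] := IH (rcons w false).
have mT : measurable (if C true then piece (rcons w true) Cs else set0).
  by case: ifP.
have mF : measurable (if C false then piece (rcons w false) Cs else set0).
  by case: ifP.
rewrite E; split; first exact: measurableU.
rewrite big_cons /mass.
have H (b : bool) A (r : R) : lebesgue_measure A = r%:E ->
  lebesgue_measure (if b then A else set0) = (b%:R * r)%:E :> \bar R.
  by case: b => [->|_]; rewrite ?mul1r// measure0 mul0r.
have EU (A B : set R) : measurable A -> measurable B -> A `&` B = set0 ->
  lebesgue_measure (A `|` B) = (lebesgue_measure A + lebesgue_measure B)%E :> \bar R.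
  by move=> mA mB AB; exact: measureU.
rewrite EU// (H _ _ _ Et) (H _ _ _ Ef).
rewrite -EFinD !big_rcons /= /weight.
by congr (_%:E); ring.
Qed.

Lemma unit_law_digits Cs :
  unit_law [set x | digits_in p Cs x] = (\prod_(C <- Cs) mass p C)%:E.
Proof.
have [_] := lebesgue_piece [::] Cs; rewrite big_nil mul1r => <-.
rewrite /unit_law /mrestr; congr lebesgue_measure.
by apply/seteqP; split => x; rewrite /piece /unit_interval /= in_itv /= => -[].
Qed.

End Digits.

(** * Product Bernoulli laws on the conductances *)

Section Bernoulli.
Context (R : realType) (d : nat) (Lam : R) (hLam : 1 < Lam).
Local Notation Om := (Omega d hLam).

Definition endpoint (b : bool) : R := if b then Lam else 1.

Lemma endpoint_in b : endpoint b \in `[1, Lam].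
Proof. by case: b; rewrite in_itv /= lexx ltW. Qed.

(** The edges are countably many: each of them uses its own digit. *)
Definition bernoulli_env (p : R) (x : measurableTypeR R) : Om := fun e =>
  exist (fun y : R => y \in `[1, Lam]) _ (endpoint_in (digit p (pickle e) x)).

Lemma measurable_bernoulli_env p : measurable_fun setT (bernoulli_env p).
Proof.
apply: measurable_to_Omega => e.
rewrite (_ : (fun x => _) = (fun x => if digit p (pickle e) x then Lam else 1))//.
by apply: measurable_fun_ifT => //; exact: measurable_digit.
Qed.

HB.instance Definition _ p :=
  isMeasurableFun.Build _ _ _ _ (bernoulli_env p) (measurable_bernoulli_env p).

Definition bernoulli_law p : probability Om R :=
  distribution (@unit_law R) (bernoulli_env p).

Definition two_valued : set Om :=
  [set a | forall e, cond a e = endpoint (cond a e == Lam)].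

Lemma two_valued_env p x : two_valued (bernoulli_env p x).
Proof.
move=> e; rewrite /cond /=; case: digit; rewrite /endpoint ?eqxx//.
by rewrite lt_eqF.
Qed.

(** The law is an image measure carried by two-valued environments, so that the
    preimages of the two events coincide. *)
Lemma bernoulli_law_ext p (A B : set Om) :
  (forall a, two_valued a -> A a <-> B a) -> bernoulli_law p A = bernoulli_law p B.
Proof.
move=> AB; rewrite /bernoulli_law /distribution /pushforward; congr (unit_law _).
by apply/seteqP; split => x /(AB _ (two_valued_env p x)).
Qed.

Lemma Rintegral_bernoulli_ext p (f g : Om -> R) :
  measurable_fun setT f -> measurable_fun setT g ->
  (forall a, 0 <= f a) -> (forall a, 0 <= g a) ->
  (forall a, two_valued a -> f a = g a) ->
  \int[bernoulli_law p]_a f a = \int[bernoulli_law p]_a g a.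
Proof.
move=> mf mg f0 g0 fg; rewrite /Rintegral; congr fine.
rewrite !ge0_integral_distribution//; try exact/measurable_EFinP.
by apply: eq_integral => x _ /=; rewrite fg//; exact: two_valued_env.
Qed.

Lemma bernoulli_box p (s : seq (edge d)) (B : edge d -> set R) : 0 < p < 1 ->
  uniq s -> bernoulli_law p (box s B) =
    (\prod_(e <- s) mass p (fun b => `[< B e (endpoint b) >]))%:E.
Proof.
move=> p01 us.
have [N sN] : exists N, forall e, e \in s -> (pickle e < N)%N.
  by exists (\max_(e <- s) pickle e).+1 => e es; rewrite ltnS; exact: leq_bigmax_seq.
(* The constraint on the [i]-th digit: that of the edge of [s] with code [i], if
   there is one, and none otherwise. *)
pose C (t : seq (edge d)) (i : nat) (b : bool) : bool :=
  all (fun e => (pickle e == i) ==> `[< B e (endpoint b) >]) t.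
transitivity (unit_law [set x | digits_in p (mkseq (C s) N) x]).
  congr (unit_law _); apply/seteqP; split => x.
    move=> H /=; rewrite digits_inP; apply/forallP => i; apply/allP => e es.
    by apply/implyP => /eqP <-; apply/asboolP; exact: (H e es).
  rewrite /= digits_inP => /forallP H e es.
  have /allP/(_ _ es) := H (Ordinal (sN e es)).
  by rewrite /= eqxx => /asboolP.
rewrite unit_law_digits// /mkseq big_map -{1}(subn0 N) -/(index_iota 0 N) big_mkord.
congr (_%:E).
elim: s us sN => [|e s IH] /=.
  by move=> _ _; rewrite big_nil big1// => i _; rewrite /mass /= !mul1r subrKC.
move=> /andP[es us] sN; rewrite big_cons -IH//; last first.
  by move=> e' e's; apply: sN; rewrite inE e's orbT.
have eN := sN e (mem_head _ _).
rewrite (bigD1 (Ordinal eN))//= [X in _ = _ * X](bigD1 (Ordinal eN))//=.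
have CT b : C s (pickle e) b = true.
  apply/allP => e' e's; apply/implyP => /eqP/(pcan_inj pickleK) E.
  by rewrite -E e's in es.
have CE i b : C (e :: s) i b = ((pickle e == i) ==> `[< B e (endpoint b) >]) && C s i b.
  by [].
have -> : mass p (C s (pickle e)) = 1 by rewrite /mass !CT !mul1r subrKC.
rewrite mul1r; congr (_ * _); first by rewrite /mass !CE !CT eqxx !andbT.
apply: eq_bigr => i ie; congr (mass p _).
apply/funext => b; rewrite CE (_ : pickle e == i = false)//.
by apply/negbTE; apply: contra ie => /eqP E; apply/eqP/val_inj.
Qed.

Lemma bernoulli_iid p : 0 < p < 1 -> iid (bernoulli_law p).
Proof.
move=> p01.
have one e (B : set R) : bernoulli_law p [set a | B (cond a e)] =
    (mass p (fun b => `[< B (endpoint b) >]))%:E.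
  transitivity (bernoulli_law p (box [:: e] (fun=> B))).
    congr (bernoulli_law p _); apply/seteqP; split => a /=.
      by move=> H e'; rewrite inE => /eqP ->.
    by apply; rewrite inE.
  by rewrite bernoulli_box// big_seq1.
split=> [e e' B _|s B us _]; first by rewrite !one.
apply: etrans (bernoulli_box _ p01 us) _.
by rewrite -prodEFin; apply: eq_bigr => e _; rewrite one.
Qed.

End Bernoulli.

(** * Likelihood ratios of adaptive readings *)

Lemma cauchy_schwarz2 (R : realDomainType) (m m' A A' x x' : R) :
  0 <= A -> 0 <= A' -> 0 <= x -> 0 <= x' ->
  m ^+ 2 <= A * x -> m' ^+ 2 <= A' * x' ->
  (m + m') ^+ 2 <= (A + A') * (x + x').
Proof.
move=> A0 A'0 x0 x'0 H H'.
suff : 2 * (m * m') <= A * x' + A' * x by nra.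
apply: le_trans (ler_norm _) _.
rewrite -ler_sqr ?nnegrE ?addr_ge0 ?mulr_ge0// real_normK ?num_real//.
have : m ^+ 2 * m' ^+ 2 <= (A * x) * (A' * x').
  by apply: ler_pM => //; exact: sqr_ge0.
have := sqr_ge0 (A * x' - A' * x); nra.
Qed.

(** Bernoulli's inequality, in a form that bounds [(1 + x) ^+ k] from above. *)
Lemma expr1D_le (R : realDomainType) (x : R) k : 0 <= x ->
  (1 + x) ^+ k * (1 - k%:R * x) <= 1.
Proof.
move=> x0; elim: k => [|k IH]; first by rewrite expr0 mul0r subr0 mulr1.
apply: le_trans IH; rewrite exprSr -mulrA ler_wpM2l ?exprn_ge0 ?addr_ge0//.
rewrite -natr1; have : 0 <= k%:R :> R by []; nra.
Qed.

Section Adaptive.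
Context (E V : Type).

(** The recursion peels off the first query, not the last one: [k] queries that
    continue the transcript [t] are a decision tree of depth [k]. *)
Fixpoint adaptive_run (query : seq V -> option E) (read : E -> V) (t : seq V)
    (k : nat) : seq V :=
  if k is k'.+1 then
    if query t is Some e then adaptive_run query read (rcons t (read e)) k' else t
  else t.

Lemma adaptive_runS query read t k : adaptive_run query read t k.+1 =
  let u := adaptive_run query read t k in
  if query u is Some e then rcons u (read e) else u.
Proof.
elim: k t => [|k IH] t //.
rewrite [LHS]/=; case Q: (query t) => [e|] /=; rewrite Q; last by rewrite Q.
exact: IH.
Qed.

Lemma eq_adaptive_run query read read' t k : read =1 read' ->
  adaptive_run query read t k = adaptive_run query read' t k.
Proof.
by move=> rr'; elim: k t => //= k IH t; case: (query t) => // e; rewrite rr' IH.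
Qed.

End Adaptive.

Section ChiSquare.
Context (R : realType) (d : nat) (Lam : R) (hLam : 1 < Lam).
Local Notation Om := (Omega d hLam).
Local Notation ep := (endpoint Lam).
Local Notation Pr p := (@bernoulli_law R d Lam hLam p).

(** Reading [ep (bit a e)] instead of [cond a e] changes nothing for two-valued
    environments, and leaves only finitely many transcripts of a given length:
    events about transcripts become measurable for arbitrary query rules. *)
Definition bit (a : Om) (e : edge d) : bool := cond a e == Lam.

Lemma measurable_bit e b : measurable [set a | bit a e = b].
Proof.
have H : measurable [set a : Om | bit a e].
  rewrite (_ : mkset _ = setT `&` (fun a : Om => cond a e) @^-1` [set Lam]).
    exact: measurable_cond.
  by rewrite setTI; apply/seteqP; split => a; rewrite /bit /= => /eqP.
case: b; first exact: H.
rewrite (_ : mkset _ = ~` [set a : Om | bit a e]); first exact: measurableC.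
by apply/seteqP; split => a; [move=> /= ->|move=> /negP/negbTE].
Qed.

Lemma endpoint_eqLam b : (ep b == Lam) = b.
Proof. by case: b; rewrite /endpoint ?eqxx// lt_eqF. Qed.

Lemma mass_endpoint (p : R) b : mass p (fun b' => `[< ep b' = ep b >]) = weight p b.
Proof.
have H b' : `[< ep b' = ep b >] = (b' == b).
  apply/asboolP/eqP => [E|->//].
  by rewrite -(endpoint_eqLam b') E endpoint_eqLam.
by rewrite /mass !H /weight; case: b {H}; rewrite /= ?mul1r ?mul0r ?addr0 ?add0r.
Qed.

Definition cyl (s : seq (edge d)) (w : edge d -> bool) : set Om :=
  box s (fun e => [set ep (w e)]).

Lemma bernoulli_cyl (p : R) s w : 0 < p < 1 -> uniq s ->
  Pr p (cyl s w) = (\prod_(e <- s) weight p (w e))%:E.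
Proof.
move=> p01 us; rewrite /cyl bernoulli_box//; congr (_%:E).
by apply: eq_bigr => e _; exact: mass_endpoint.
Qed.

Context (query : seq R -> option (edge d)) (T : pred (seq R)).

Definition accept t k : set Om :=
  [set a | T (adaptive_run query (fun e => ep (bit a e)) t k)].

Lemma accept_const t k : query t = None -> accept t k = [set a | T t].
Proof. by move=> Q; case: k => [|k]; rewrite /accept /= ?Q. Qed.

Lemma measurable_const (b : bool) : measurable [set a : Om | b].
Proof.
case: b; first by rewrite (_ : mkset _ = setT)//; apply/seteqP; split.
by rewrite (_ : mkset _ = set0)//; apply/seteqP; split.
Qed.

Lemma measurable_accept t k : measurable (accept t k).
Proof.
elim: k t => [|k IH] t; first exact: (measurable_const (T t)).
case Q: (query t) => [e|]; last first.
  by rewrite accept_const//; exact: (measurable_const (T t)).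
rewrite (_ : accept t k.+1 =
  ([set a | bit a e = true] `&` accept (rcons t (ep true)) k) `|`
  ([set a | bit a e = false] `&` accept (rcons t (ep false)) k)).
  by apply: measurableU; apply: measurableI => //; exact: measurable_bit.
apply/seteqP; split => a; rewrite /accept /= Q.
  by case B: (bit a e); [left|right].
by case=> -[->].
Qed.

Lemma measurable_cyl s w : measurable (cyl s w).
Proof. by apply: measurable_box. Qed.

Definition extend (w : edge d -> bool) e b : edge d -> bool :=
  fun e' => if e' == e then b else w e'.

Lemma cyl_extend s w e b : e \notin s ->
  cyl (e :: s) (extend w e b) = cyl s w `&` [set a | cond a e = ep b].
Proof.
move=> es; apply/seteqP; split => a H.
  split; last by have := H e (mem_head _ _); rewrite /extend eqxx.
  move=> e' e's; have := H e'; rewrite inE e's orbT /extend => /(_ isT).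
  by case: eqP => // E; rewrite -E e's in es.
move=> e'; rewrite inE /extend; case: eqP => [->|_] /=; first by case: H.
by case: H => + _; exact.
Qed.

Lemma prob_split (p : R) s w e t k : query t = Some e -> e \notin s ->
  fine (Pr p (cyl s w `&` accept t k.+1)) =
  fine (Pr p (cyl (e :: s) (extend w e true) `&` accept (rcons t (ep true)) k)) +
  fine (Pr p (cyl (e :: s) (extend w e false) `&` accept (rcons t (ep false)) k)).
Proof.
move=> Q es; pose S b := cyl (e :: s) (extend w e b) `&` accept (rcons t (ep b)) k.
have mS b : measurable (S b).
  by apply: measurableI; [exact: measurable_cyl|exact: measurable_accept].
rewrite -fineD; [|exact: (fin_num_measure _ _ (mS _))..].
rewrite -measureU; first last.
- apply/seteqP; split => // a [[+ _] [+ _]].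
  rewrite !cyl_extend// => -[_ /= ->] [_ /=] E.
  by have := hLam; rewrite E ltxx.
- exact: mS.
- exact: mS.
congr fine; apply: bernoulli_law_ext => a tv.
rewrite !cyl_extend// /accept /= Q /=.
split=> [[ca Ta]|].
  by case B: (bit a e) Ta => Ta; [left|right]; split=> //; split=> //;
    rewrite tv -/(bit a e) B.
have hb b : cond a e = ep b -> bit a e = b by move=> E; rewrite /bit E endpoint_eqLam.
by case=> -[[ca E] Ta]; split=> //; [rewrite (hb true E)|rewrite (hb false E)].
Qed.

(** Cauchy-Schwarz along the decision tree, with the values already known recorded
    by the cylinder.  Reading a known edge again gives no information.  Reading a
    new edge splits the cylinder in two, and multiplies the sum of squared
    likelihood ratios by that of a single Bernoulli variable. *)
Lemma chi_square_cyl (p q : R) t k s w : 0 < p < 1 -> 0 < q < 1 -> uniq s ->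
  fine (Pr p (cyl s w `&` accept t k)) ^+ 2 * \prod_(e <- s) weight q (w e) <=
  fine (Pr q (cyl s w `&` accept t k)) * (\prod_(e <- s) weight p (w e)) ^+ 2 *
  (p ^+ 2 / q + (1 - p) ^+ 2 / (1 - q)) ^+ k.
Proof.
move=> p01 q01; have [q0 q1] := andP q01; have [p0 p1] := andP p01.
set K := p ^+ 2 / q + (1 - p) ^+ 2 / (1 - q).
have r0 : 0 < 1 - q by lra.
(* [K] is one plus the chi-square distance between two Bernoulli variables. *)
have K1 : 1 <= K.
  rewrite -subr_ge0; have -> : K - 1 = (p - q) ^+ 2 / (q * (1 - q)).
    by rewrite /K; field; rewrite !gt_eqF.
  by rewrite divr_ge0 ?sqr_ge0// mulr_ge0// ltW.
have weight_gt0 b : 0 < weight q b by case: b; rewrite /weight; lra.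
have base s' w' (b : bool) j : uniq s' ->
    fine (Pr p (cyl s' w' `&` [set a | b])) ^+ 2 * \prod_(e <- s') weight q (w' e) <=
    fine (Pr q (cyl s' w' `&` [set a | b])) * (\prod_(e <- s') weight p (w' e)) ^+ 2 * K ^+ j.
  move=> us'; have Kj : 1 <= K ^+ j by rewrite exprn_ege1.
  case: b; last first.
    rewrite (_ : mkset _ = set0); last by apply/seteqP; split.
    by rewrite setI0 !measure0 /= expr0n !mul0r.
  rewrite (_ : mkset _ = setT); last by apply/seteqP; split.
  rewrite setIT !bernoulli_cyl//= mulrC ler_peMr// mulr_ge0 ?sqr_ge0//.
  by apply: prodr_ge0 => e _; exact: ltW.
elim: k t s w => [|k IH] t s w us; first exact: (base s w (T t) 0%N us).
case Q: (query t) => [e|]; last by rewrite accept_const//; exact: base.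
have [es|es] := boolP (e \in s).
  have -> : cyl s w `&` accept t k.+1 = cyl s w `&` accept (rcons t (ep (w e))) k.
    apply/seteqP; split => a [ca]; rewrite /accept /= Q /bit (ca e es)
      endpoint_eqLam => Ta; split => //.
  apply: le_trans (IH _ _ _ us) _; rewrite ler_wpM2l//.
    by rewrite mulr_ge0 ?sqr_ge0// fine_ge0.
  by rewrite exprS ler_peMl// exprn_ge0// (le_trans ler01).
rewrite !(@prob_split _ _ w _ _ k Q es).
set m1 := fine (Pr p (cyl _ (extend w e true) `&` _)).
set m0 := fine (Pr p (cyl _ (extend w e false) `&` _)).
set n1 := fine (Pr q (cyl _ (extend w e true) `&` _)).
set n0 := fine (Pr q (cyl _ (extend w e false) `&` _)).
have H b := IH (rcons t (ep b)) (e :: s) (extend w e b).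
have prod_ext r b : \prod_(e' <- e :: s) weight r (extend w e b e') =
    weight r b * \prod_(e' <- s) weight r (w e').
  rewrite big_cons /extend eqxx; congr (_ * _); apply: eq_big_seq => e' e's.
  by case: eqP => // E; rewrite -E e's in es.
have us' : uniq (e :: s) by rewrite /= es.
have := H true us'; have := H false us'; rewrite !prod_ext -/m1 -/m0 -/n1 -/n0.
set N := \prod_(_ <- _) weight q _; set M := \prod_(_ <- _) weight p _.
have N0 : 0 < N by apply: prodr_gt0.
have Kk : 0 <= K ^+ k by rewrite exprn_ge0// (le_trans ler01).
have n10 : 0 <= n1 by exact: fine_ge0.
have n00 : 0 <= n0 by exact: fine_ge0.
rewrite /weight => H0 H1.
have M2 : 0 <= M ^+ 2 by exact: sqr_ge0.
set A1 := n1 * M ^+ 2 * K ^+ k; set A0 := n0 * M ^+ 2 * K ^+ k.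
rewrite -ler_pdivlMr//.
have -> : (n1 + n0) * M ^+ 2 * K ^+ k.+1 / N =
  (A1 + A0) * (p ^+ 2 / (q * N) + (1 - p) ^+ 2 / ((1 - q) * N)).
  rewrite [K ^+ k.+1]exprS /A1 /A0; move: (K ^+ k) => L.
  by rewrite /K; field; rewrite !gt_eqF.
have bound m n x y : 0 < y -> m ^+ 2 * (y * N) <= n * (x * M) ^+ 2 * K ^+ k ->
    m ^+ 2 <= n * M ^+ 2 * K ^+ k * (x ^+ 2 / (y * N)).
  move=> y0 H'; rewrite mulrA ler_pdivlMr ?mulr_gt0//.
  by apply: le_trans H' _; rewrite exprMn le_eqVlt; apply/orP; left; apply/eqP; ring.
have A_ge0 n : 0 <= n -> 0 <= n * M ^+ 2 * K ^+ k.
  by move=> n_ge0; apply: mulr_ge0 => //; exact: mulr_ge0.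
have x_ge0 x y : 0 < y -> 0 <= x ^+ 2 / (y * N).
  by move=> y0; rewrite divr_ge0 ?sqr_ge0// ltW// mulr_gt0.
by apply: cauchy_schwarz2; [exact: A_ge0|exact: A_ge0|exact: x_ge0|exact: x_ge0|
  exact: bound|exact: bound].
Qed.

Lemma chi_square_accept (p q : R) k : 0 < p < 1 -> 0 < q < 1 ->
  fine (Pr p (accept [::] k)) ^+ 2 <=
  fine (Pr q (accept [::] k)) * (1 + (p - q) ^+ 2 / (q * (1 - q))) ^+ k.
Proof.
move=> p01 q01; have [q0 q1] := andP q01.
have := @chi_square_cyl p q [::] k [::] xpredT p01 q01 isT.
rewrite (_ : cyl _ _ = setT); last by apply/seteqP; split.
rewrite !setTI !big_nil expr1n !mulr1.
suff -> : p ^+ 2 / q + (1 - p) ^+ 2 / (1 - q) = 1 + (p - q) ^+ 2 / (q * (1 - q)) by [].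
by field; rewrite !gt_eqF// subr_gt0.
Qed.

End ChiSquare.

(** * Two laws that an algorithm cannot tell apart *)

Section LowerBound.
Context (R : realType) (d : nat) (Lam : R) (hLam : 1 < Lam).
Local Notation Om := (Omega d hLam).
Local Notation Pr p := (@bernoulli_law R d Lam hLam p).
Context (alg : algorithm d hLam).

Lemma readsE delta (a : Om) n :
  reads (query alg) delta a n = adaptive_run (query alg delta) (cond a) [::] n.
Proof. by elim: n => // n IH; rewrite adaptive_runS -IH. Qed.

Lemma reads_stop delta (a : Om) m n : (m <= n)%N ->
  query alg delta (reads (query alg) delta a m) = None ->
  reads (query alg) delta a n = reads (query alg) delta a m.
Proof.
move=> /subnKC <- Q; elim: (n - m)%N => [|k IH]; first by rewrite addn0.
by rewrite addnS /= IH Q.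
Qed.

Lemma halted delta (a : Om) n : 0 < delta -> (nops alg delta a <= n)%N ->
  query alg delta (reads (query alg) delta a n) = None.
Proof.
move=> delta0 Nn; have := stops alg a delta0 => Q.
by rewrite (reads_stop Nn Q).
Qed.

(** The number of operations may depend on conductances that were never read, but
    the transcript is final as soon as the query rule stops: given that, the
    estimate is a function of the first [n] readings alone. *)
Lemma estimate_halted delta (a : Om) n : 0 < delta ->
  query alg delta (reads (query alg) delta a n) = None ->
  estimate alg delta a = output alg delta (reads (query alg) delta a n).
Proof.
move=> delta0 Q; have Q' := stops alg a delta0; rewrite /estimate.
by have [nN|/ltnW Nn] := leqP n (nops alg delta a);
  [rewrite (reads_stop nN Q)|rewrite (reads_stop Nn Q')].
Qed.

Definition far (A : 'M[R]_d) i delta : set Om :=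
  [set a | 2 * delta <= `|A i i - estimate alg delta a i i|].

Lemma measurable_far A i delta : 0 < delta -> measurable (far A i delta).
Proof.
move=> delta0; rewrite (_ : far A i delta = setT `&`
  (fun a => `|A i i - estimate alg delta a i i|) @^-1` [set` `[2 * delta, +oo[ ]).
  have mf : measurable_fun setT (fun a => `|A i i - estimate alg delta a i i|).
    apply: measurableT_comp => //; apply: measurable_funB => //.
    exact: measurable_estimate.
  by apply: mf => //; exact: measurable_itv.
by rewrite setTI; apply/seteqP; split => a; rewrite /far /= in_itv /= andbT.
Qed.

(** Chebyshev's inequality: the mean square error bounds that of each entry. *)
Lemma prob_far_le (P : probability Om R) A i delta : 0 < delta ->
  (L2norm P (fun a => (A - estimate alg delta a)%R) <= delta%:E)%E ->
  (P (far A i delta) <= (4^-1)%:E)%E.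
Proof.
move=> delta0; rewrite /L2norm; set X := 'E_P[_]%E => H.
have X0 : (0 <= X)%E.
  by apply: expectation_ge0 => a; do 2![apply: sumr_ge0 => ? _]; exact: sqr_ge0.
have {H}X_le : (X <= (delta ^+ 2)%:E)%E.
  move: X X0 H => [r| |]//; last by rewrite poweRyr ?invr_eq0 ?pnatr_eq0// leye_eq.
  rewrite lee_fin => r0; rewrite poweR_EFin !lee_fin powR12_sqrt// => H.
  by rewrite -(sqr_sqrtr r0) lerXn2r ?nnegrE ?sqrtr_ge0// ltW.
have mfar := measurable_far A i delta0.
have : ((4 * delta ^+ 2)%:E * P (far A i delta) <= X)%E.
  have -> : P (far A i delta) = (\int[P]_a (\1_(far A i delta) a)%:E)%E.
    by rewrite integral_indic// setIT.
  have mI : measurable_fun setT (fun a => (\1_(far A i delta) a : R)%:E).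
    by apply/measurable_EFinP; exact: measurable_indic.
  have c0 : 0 <= 4 * delta ^+ 2 by rewrite mulr_ge0// sqr_ge0.
  rewrite -ge0_integralZl_EFin//.
  rewrite /X unlock; apply: ge0_le_integral => //.
  - by move=> a _; rewrite -EFinM lee_fin mulr_ge0.
  - exact: measurable_funeM.
  - apply/measurable_EFinP; apply: measurable_sum => k; apply: measurable_sum => l.
    apply: measurable_funX.
    rewrite [X in measurable_fun _ X](_ : _ =
        (fun a => A k l - estimate alg delta a k l)); last first.
      by apply/funext => a; rewrite !mxE.
    by apply: measurable_funB => //; exact: measurable_estimate.
  move=> a _; rewrite -EFinM lee_fin indicE.
  have S0 : 0 <= sqnorm (A - estimate alg delta a).
    by do 2![apply: sumr_ge0 => ? _]; exact: sqr_ge0.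
  have [|] := boolP (a \in far A i delta); last by rewrite mulr0.
  rewrite inE /far /= mulr1 => H.
  apply: (@le_trans _ _ ((A i i - estimate alg delta a i i) ^+ 2)).
    rewrite -[leRHS]real_normK ?num_real//.
    by have := ltW delta0; move: H; move: `|_| => y *; nra.
  rewrite /sqnorm (bigD1 i)//= (bigD1 i)//= !mxE -!addrA lerDl addr_ge0//.
    by apply: sumr_ge0 => ? _; exact: sqr_ge0.
  by do 2![apply: sumr_ge0 => ? _]; exact: sqr_ge0.
move=> /le_trans/(_ X_le).
have <- := @fineK _ (P (far A i delta)) (fin_num_measure _ _ mfar).
rewrite -EFinM !lee_fin; have : 0 < delta ^+ 2 by rewrite exprn_gt0.
nra.
Qed.

(** The event [acc] that the algorithm stops within [n] readings at a distance less
    than [2 delta] from [Ap] has probability at least [1 - 1/4 - 1/8 = 5/8] under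
    [p].  If the two matrices were [4 delta] apart, it would have probability at
    most [1/4] under [q].  The chi-square bound then forces
    [25/64 <= (1/4) (4/3)], which is false. *)
Lemma two_point_bound (p q : R) (Ap Aq : 'M[R]_d) i delta n :
  0 < p < 1 -> 0 < q < 1 -> 0 < delta ->
  (L2norm (Pr p) (fun a => (Ap - estimate alg delta a)%R) <= delta%:E)%E ->
  (L2norm (Pr q) (fun a => (Aq - estimate alg delta a)%R) <= delta%:E)%E ->
  (Pr p [set a | (n < nops alg delta a)%N] <= (8^-1)%:E)%E ->
  n%:R * ((p - q) ^+ 2 / (q * (1 - q))) <= 4^-1 ->
  `|Ap i i - Aq i i| < 4 * delta.
Proof.
move=> p01 q01 delta0 Hp Hq HN Hn; rewrite ltNge; apply/negP => gap.
pose T (t : seq R) := (query alg delta t == None) &&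
  (`|Ap i i - output alg delta t i i| < 2 * delta).
pose acc : set Om := @accept R d Lam hLam (query alg delta) T [::] n.
have macc : measurable acc by exact: measurable_accept.
have mN : measurable [set a : Om | (n < nops alg delta a)%N].
  rewrite (_ : mkset _ = setT `&` nops alg delta @^-1` [set m | (n < m)%N]).
    by apply: measurable_nops.
  by rewrite setTI.
have accE a : two_valued a -> acc a <->
    query alg delta (reads (query alg) delta a n) = None /\
    `|Ap i i - output alg delta (reads (query alg) delta a n) i i| < 2 * delta.
  move=> tv; rewrite /acc /accept /= readsE.
  rewrite (@eq_adaptive_run _ _ _ _ (cond a)) => [|e]; last by rewrite [RHS]tv.
  by split=> [/andP[/eqP]|[? ?]] //; rewrite /T; apply/andP; split => //; exact/eqP.
have mfp := measurable_far Ap i delta0; have mfq := measurable_far Aq i delta0.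
have acc_p : 5 / 8 <= fine (Pr p acc).
  have : (1 <= Pr p acc + Pr p (far Ap i delta) +
      Pr p [set a | (n < nops alg delta a)%N])%E.
    rewrite -(probability_setT (Pr p)).
    rewrite (_ : Pr p setT = Pr p (acc `|` far Ap i delta `|`
      [set a | (n < nops alg delta a)%N])); last first.
      apply: bernoulli_law_ext => a tv; split=> // _.
      have [Nn|nN] := leqP (nops alg delta a) n; last by right.
      left; have Q := halted delta0 Nn.
      have [lt2|ge2] := ltP `|Ap i i - estimate alg delta a i i| (2 * delta).
        by left; apply/(accE a tv); split => //; rewrite -(estimate_halted delta0 Q).
      by right.
    apply: le_trans (measureU2 _ _ _) _ => //; first exact: measurableU.
    by apply: leeD => //; exact: measureU2.
  have := prob_far_le i delta0 Hp.
  move: HN.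
  have <- := @fineK _ (Pr p acc) (fin_num_measure _ _ macc).
  have <- := @fineK _ (Pr p (far Ap i delta)) (fin_num_measure _ _ mfp).
  have <- := @fineK _ (Pr p [set a | (n < nops alg delta a)%N]) (fin_num_measure _ _ mN).
  rewrite -!EFinD !lee_fin fineK ?fin_num_measure//.
  lra.
have acc_q : fine (Pr q acc) <= 4^-1.
  rewrite -lee_fin fineK ?fin_num_measure//; apply: le_trans (prob_far_le i delta0 Hq).
  rewrite (_ : Pr q acc = Pr q (acc `&` far Aq i delta)); last first.
    apply: bernoulli_law_ext => a tv; split=> [aa|[]//]; split => //.
    have [Q lt2] := (accE a tv).1 aa.
    rewrite /far /= (estimate_halted delta0 Q).
    move: gap lt2; set o := output _ _ _ _ _ => gap lt2.
    have := ler_distD o (Ap i i) (Aq i i); rewrite (distrC o); lra.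
  by apply: le_measure; rewrite ?inE//; exact: measurableI.
have := @chi_square_accept R d Lam hLam (query alg delta) T p q n p01 q01.
rewrite -/acc; set x := _ / _ in Hn *.
have x0 : 0 <= x.
  have [q0 q1] := andP q01.
  by rewrite divr_ge0 ?sqr_ge0// mulr_ge0// ?subr_ge0 ltW.
have := expr1D_le n x0.
have : 1 <= (1 + x) ^+ n by rewrite exprn_ege1// lerDl.
have : 0 <= fine (Pr q acc) by exact: fine_ge0.
move: acc_p acc_q Hn; move: (fine _) (fine _) ((1 + x) ^+ n) (n%:R * x) => m m' K y.
move=> *; nra.
Qed.

End LowerBound.

(** * The homogenized coefficient as a function of the Bernoulli parameter *)

Lemma is_derive0 (R : realType) (f : R -> R) (p : R) :
  (forall c : R, 0 < c -> \forall h \near 0^', `|f (p + h) - f p| <= c * `|h|) ->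
  is_derive p 1 f 0.
Proof.
move=> H.
have cv : (h^-1 *: ((f \o shift p) (h *: 1) - f p)) @[h --> 0^'] --> (0 : R).
  apply/cvgr0Pnorm_le => c c0; near=> h.
  have h0 : h != 0 by near: h; exact: nbhs_dnbhs_neq.
  rewrite normrZ normfV ler_pdivrMl ?normr_gt0// mulrC /= [h *: 1]mulr1 [h + p]addrC.
  by near: h; exact: H.
apply: DeriveDef; first by apply/cvg_ex; exists 0.
by apply/cvg_lim.
Unshelve. all: by end_near.
Qed.

Section Conclusion.
Context (R : realType) (d : nat) (Lam : R) (hLam : 1 < Lam).
Local Notation Om := (Omega d hLam).
Local Notation Pr p := (@bernoulli_law R d Lam hLam p).

Lemma bernoulli_bit (p : R) e : 0 < p < 1 ->
  Pr p [set a | bit a e = true] = p%:E.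
Proof.
move=> p01; have us : uniq [:: e] by [].
have := @bernoulli_cyl R d Lam hLam p [:: e] xpredT p01 us.
rewrite big_seq1 /weight => <-; congr (Pr p _).
apply/seteqP; split => a /=.
  by rewrite /bit => /eqP ca e'; rewrite inE => /eqP ->.
by move=> /(_ e (mem_head _ _)) ca; rewrite /bit ca eqxx.
Qed.

Lemma mean_cond (p : R) e : 0 < p < 1 ->
  \int[Pr p]_a cond a e = 1 + (Lam - 1) * p.
Proof.
move=> p01.
have mb := @measurable_bit R d Lam hLam e true.
have iI : (Pr p).-integrable setT
    (EFin \o (fun a => \1_[set a : Om | bit a e = true] a : R)).
  exact: integrable_indic.
have ZI := integrableZl measurableT (Lam - 1) iI.
have i1 : (Pr p).-integrable setT (EFin \o (fun=> 1)).
  exact: finite_measure_integrable_cst.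
have -> : 1 + (Lam - 1) * p =
    \int[Pr p]_a (1 + (Lam - 1) * \1_[set a : Om | bit a e = true] a).
  rewrite RintegralD// RintegralZl// Rintegral_probability; congr (_ + _ * _).
  by rewrite /Rintegral integral_indic// setIT (congr1 fine (bernoulli_bit e p01)).
apply: Rintegral_bernoulli_ext.
- exact: measurable_cond.
- by apply: measurable_funD => //; apply: measurable_funM => //; exact: measurable_indic.
- by move=> a; rewrite (le_trans ler01)// cond_ge1.
- by move=> a; rewrite addr_ge0// mulr_ge0// ?subr_ge0 ?ltW.
move=> a tv; rewrite (tv e) indicE -/(bit a e).
have -> : (a \in [set a' | bit a' e = true]) = bit a e.
  by apply/idP/idP; rewrite inE.
by case: (bit a e); rewrite /endpoint ?mulr1 ?mulr0 ?addr0// subrKC.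
Qed.

Context (alg : algorithm d hLam) (A : R -> 'M[R]_d) (i : 'I_d).
Hypothesis accurate : forall p : R, 0 < p < 1 -> forall delta : R, 0 < delta ->
  (L2norm (Pr p) (fun a => (A p - estimate alg delta a)%R) <= delta%:E)%E.
Hypothesis fast : forall p : R, 0 < p < 1 -> forall eps : R, 0 < eps ->
  Pr p [set a | eps < delta ^+ 2 * (nops alg delta a)%:R]
    @[delta --> 0^'+] --> (0 : \bar R)%E.

(** The accuracy is tied to the increment by [delta = c |h| / 4].  The constant in
    [eps = c ^ 2 p (1 - p) / 128] makes [eps / delta ^ 2] readings worth
    [h ^ 2 eps / (delta ^ 2 q (1 - q)) <= 1 / 4] as soon as
    [q (1 - q) >= p (1 - p) / 2]. *)
Lemma derivative_eq0 (p : R) : 0 < p < 1 -> is_derive p 1 (fun r => A r i i) 0.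
Proof.
move=> p01; have [p0 p1] := andP p01; apply: is_derive0 => c c0.
have v0 : 0 < p * (1 - p) by rewrite mulr_gt0// subr_gt0.
set v := p * (1 - p) in v0.
pose eps := c ^+ 2 * v / 128.
have eps0 : 0 < eps by rewrite divr_gt0// mulr_gt0// exprn_gt0.
have e8 : (0 : R) < 8^-1 by rewrite invr_gt0.
have N8 : nbhs (0 : \bar R)%E [set y : \bar R | (y < (8^-1)%:E)%E].
  exact: (@nbhs_open_ereal_lt _ 0 (fun=> 8^-1) e8).
have /(_ _ N8) [delta0 /= delta00 small] := fast p01 eps0.
have c4 : 0 < c / 4 by rewrite divr_gt0.
have [r r0 Hr] : exists2 r : R, 0 < r & forall h : R, `|h| < r ->
    `|h| <= v / 4 /\ c / 4 * `|h| < delta0.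
  exists (Num.min (v / 4) (delta0 / (c / 4))).
    by rewrite lt_min !divr_gt0.
  move=> h; rewrite lt_min => /andP[/ltW hv]; rewrite ltr_pdivlMr// => hd.
  by split=> //; rewrite (mulrC (c / 4)).
have : \forall h \near (0 : R)^', `|h| < r /\ h != 0.
  near=> h; split; last by near: h; exact: nbhs_dnbhs_neq.
  near: h; apply: dnbhs0_lt => //.
apply: filterS => h [/Hr[hv hdelta] h0].
have nh0 : 0 < `|h| by rewrite normr_gt0.
pose q := p + h; pose delta := c / 4 * `|h|.
have dl0 : 0 < delta by rewrite mulr_gt0.
have hb : - (v / 4) <= h <= v / 4 by rewrite -ler_norml.
have [h1 h2] := andP hb.
have q01 : 0 < q < 1 by rewrite /q; apply/andP; split; move: h1 h2 v0; rewrite /v; nra.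
have vq : v / 2 <= q * (1 - q) by rewrite /q; move: h1 h2 v0; rewrite /v; nra.
have vq0 : 0 < q * (1 - q) by lra.
have ratio0 : 0 <= eps / delta ^+ 2 by rewrite divr_ge0 ?sqr_ge0// ltW.
apply: le_trans (_ : 4 * delta <= _); last by rewrite /delta; lra.
rewrite distrC; apply/ltW.
pose n := Num.truncn (eps / delta ^+ 2).
apply: (@two_point_bound _ _ _ _ alg p q (A p) (A q) i delta n) => //.
- exact: accurate.
- exact: accurate.
- apply: le_trans (ltW (small delta _ dl0)); last first.
    by rewrite /ball_ /= sub0r normrN gtr0_norm.
  apply: le_measure; rewrite ?inE.
  + rewrite (_ : mkset _ = setT `&` nops alg delta @^-1` [set m | (n < m)%N]).
      by apply: measurable_nops.
    by rewrite setTI.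
  + rewrite (_ : mkset _ = setT `&`
        nops alg delta @^-1` [set m | eps < delta ^+ 2 * m%:R]).
      by apply: measurable_nops.
    by rewrite setTI.
  move=> a /= ltN; rewrite mulrC -ltr_pdivrMr ?exprn_gt0//.
  apply: lt_le_trans (truncnS_gt _) _.
  by rewrite ler_nat.
- have := truncn_le (eps / delta ^+ 2); rewrite ratio0 => Hn.
  apply: le_trans (ler_wpM2r _ Hn) _.
    by rewrite divr_ge0 ?sqr_ge0// ltW.
  have -> : eps / delta ^+ 2 * ((p - q) ^+ 2 / (q * (1 - q))) = v / 8 / (q * (1 - q)).
    have hh : `|h| ^+ 2 = h ^+ 2 by rewrite real_normK ?num_real.
    rewrite /eps /delta exprMn hh (_ : (p - q) ^+ 2 = h ^+ 2); last first.
      by rewrite /q opprD addrA subrr sub0r sqrrN.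
    have [qa qb] := andP q01.
    by field; rewrite h0 !gt_eqF// subr_gt0.
  by rewrite ler_pdivrMr//; lra.
Unshelve. all: by end_near.
Qed.

End Conclusion.

Theorem proposition1p1 (R : realType) (d : nat) (Lam : R)
    (hd : (2 <= d)%N) (hLam : 1 < Lam) :
  ~ exists alg : algorithm d hLam,
      forall P : probability (Omega d hLam) R, iid P ->
        (forall abar : 'M[R]_d, is_homogenized_matrix P abar ->
           forall delta : R, 0 < delta ->
             (L2norm P (fun a => (abar - estimate alg delta a)%R)
                <= delta%:E)%E) /\
        (forall eps : R, 0 < eps ->
           P [set a | eps < delta ^+ 2 * (nops alg delta a)%:R]
             @[delta --> 0^'+] --> (0 : \bar R)%E).
Proof.
move=> [alg Halg].
have i : 'I_d by exact: Ordinal (ltnW hd).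
have ex_abar (p : R) : exists abar, 0 < p < 1 ->
    is_homogenized_matrix (bernoulli_law d hLam p) abar.
  have [p01|_] := boolP (0 < p < 1); last by exists 0.
  have [abar Habar] := homogenized_matrix_exists (iid_shift (bernoulli_iid d hLam p01)).
  by exists abar.
have [A HA] := choice ex_abar.
pose f (r : R) : R := A r i i.
have Df (p : R) : 0 < p < 1 -> is_derive p 1 f 0.
  apply: (derivative_eq0 (alg := alg)) => r r01.
    exact: (Halg _ (bernoulli_iid d hLam r01)).1 (HA _ r01).
  exact: (Halg _ (bernoulli_iid d hLam r01)).2.
(* The upper bound at [p0] is [1 + (Lam - 1) / 3] and the lower bound at [p1] is
   [Lam - (Lam - 1) / 3]. *)
pose p0 : R := 3^-1; pose p1 : R := 1 - (3 * Lam)^-1.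
have Lam0 : 0 < Lam by rewrite (lt_trans ltr01).
have L3 : 0 < (3 * Lam)^-1 < 3^-1.
  have L30 : 0 < 3 * Lam by rewrite mulr_gt0.
  by rewrite invr_gt0 L30 ltf_pV2 ?posrE// ltr_pMr.
have [La Lb] := andP L3.
have p0_in : 0 < p0 < 1 by rewrite /p0; lra.
have p1_in : 0 < p1 < 1 by rewrite /p1; lra.
have p0p1 : p0 < p1 by rewrite /p0 /p1; lra.
have sub (r : R) : r \in `[p0, p1] -> 0 < r < 1.
  rewrite in_itv /= => /andP[p0r rp1]; have [p0_gt0 _] := andP p0_in.
  have [_ p1_lt1] := andP p1_in.
  by rewrite (lt_le_trans p0_gt0 p0r) (le_lt_trans rp1 p1_lt1).
have [|r rI|c _] := @MVT R f (fun=> 0) p0 p1 p0p1.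
- by move=> x xI; apply: Df; apply: sub; apply: subset_itv_oo_cc.
- apply: derivable_within_continuous => x xI.
  by have [] := Df _ (sub _ xI).
rewrite mul0r => /eqP; rewrite subr_eq0 => /eqP Ef.
have st0 := iid_shift (bernoulli_iid d hLam p0_in).
have st1 := iid_shift (bernoulli_iid d hLam p1_in).
have := homogenized_diag_le st0 i (HA _ p0_in).
have := homogenized_diag_ge st1 i (HA _ p1_in).
rewrite !mean_cond// -/(f p0) -/(f p1) Ef.
have Lu : Lam * (3 * Lam)^-1 = 3^-1.
  by field; rewrite gt_eqF.
rewrite /p1 /p0; move: Lu; move: (_^-1) => u Lu; nra.
Qed.
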